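(* Efficient ontological models are efficiently learnable. That is, for every efficient ontological model (EOM) for a set of states $\mathcal{C}=\bigcup_n\mathcal{C}_n$ under a set of two-outcome measurements $\mathcal{M}=\bigcup_n\mathcal{M}_n$, with ontic state spaces $\Lambda_n$ and outcome function $f$, there exist classical algorithms $L_1$ and $L_2$ such that: (1) for every $n$, every preparation $p$ on $\Lambda_n$, every $\eta>0$, and every training set $T=\{(E_i,d_i)\}_{i\in[m]}$ with $E_i\in\mathcal{M}_n$ and $d_i=\sum_{\lambda\in\Lambda_n}p(\lambda)f(\lambda,E_i)$, $L_1$ outputs a $\mathrm{poly}(n)$-bit classical description of a preparation $q$ on $\Lambda_n$ such that $\left|\sum_{\lambda}q(\lambda)f(\lambda,E_i)-d_i\right|\le\eta$ for all $i\in[m]$, and $L_1$ runs in time $\mathrm{poly}(n,m,1/\eta)$; (2) for every preparation $q$ on $\Lambda_n$ that is an output of $L_1$ and every $E\in\mathcal{M}_n$, $L_2$ computes $\sum_{\lambda\in\Lambda_n}q(\lambda)f(\lambda,E)$ in time $\mathrm{poly}(n)$.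
   Context: Here $\mathcal{C}_n$ is a set of $n$-qubit states and $\mathcal{M}_n$ a set of two-outcome measurements on $n$ qubits; a measurement is identified with its first POVM element $E$ and has a canonical classical description of $\mathrm{poly}(n)$ bits. Ontological model: an ontological model with ontic state space $\Lambda_n$ describes $\mathcal{C}_n$ with respect to $\mathcal{M}_n$ if there exist a function $f:\Lambda_n\times\mathcal{M}_n\to[0,1]$ and, for each $\rho\in\mathcal{C}_n$, a probability distribution $p_\rho$ over $\Lambda_n$, such that $\mathrm{Tr}(\rho E)=\sum_{\lambda\in\Lambda_n}p_\rho(\lambda)f(\lambda,E)$ for all $\rho\in\mathcal{C}_n$ and $E\in\mathcal{M}_n$. Efficient ontological model (EOM) for $\mathcal{C}$ under $\mathcal{M}$: an ontological model (one for each $n$) such that $|\Lambda_n|=O(\mathrm{poly}(n))$ and there is a classical algorithm that evaluates $f(\lambda,E)$ and $p_\rho(\lambda)$, for all $\rho\in\mathcal{C}_n$, $\lambda\in\Lambda_n$, $E\in\mathcal{M}_n$, in runtime polynomial in $n$. Preparation: a probability distribution $p:\Lambda_n\to[0,1]$ over the ontic state space. It need not equal $p_\rho$ for any quantum state $\rho$.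
   Formalization: The description length of q and the running time of L_2 are bounded by a polynomial in n and log(1/η) instead of n alone: for fixed n, finitely many poly(n)-bit descriptions cannot serve every p and every η>0. For η ≥ 2^(-poly(n)) both bounds are poly(n). *)

(* Defs.v *)
From mathcomp Require Import all_boot all_order all_algebra.
From mathcomp Require Import complex.
From mathcomp Require Import classical_sets reals.

Set Implicit Arguments.
Unset Strict Implicit.
Unset Printing Implicit Defensive.

Import Order.TTheory GRing.Theory Num.Theory.
Local Open Scope ring_scope.

(** * Classical algorithms

    A deterministic WHILE language over binary trees with integer leaves (in
    the style of Jones, "Computability and Complexity from a Programming
    Perspective").  Trees are immutable and shared, so copying, [Cons], [Hd]
    and [Tl] have unit cost; every arithmetic operation is charged the product
    of the bit lengths of its operands.  The resulting running time is
    polynomially related to that of Turing machines.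

    Real numbers that are part of an input are presented as in computable
    analysis: a program never holds a real number, but [Get] reads the i-th
    real input x to k binary digits, i.e. returns floor(2^k x), at a cost that
    is at least k plus the length of the answer. *)

Inductive tree := Int of int | Pair of tree & tree.

Inductive binop := OAdd | OSub | OMul | ODiv | OLeq.

Inductive expr :=
  | Var of nat
  | Cst of int
  | Cons of expr & expr
  | Hd of expr
  | Tl of expr
  | IsPair of expr
  | Op of binop & expr & expr.

Inductive com :=
  | Skip
  | Assign of nat & expr
  | Get of nat & expr & expr
  | Seq of com & com
  | If of expr & com & com
  | While of expr & com.

Definition store := nat -> tree.

Definition upd (s : store) (x : nat) (v : tree) : store :=
  fun y => if y == x then v else s y.

(* All operations are total: trees are read as 0 where an integer is expected,
   and Hd, Tl of an integer are 0. *)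
Definition int_of (v : tree) : int := if v is Int z then z else 0.
Definition hd (v : tree) : tree := if v is Pair a _ then a else Int 0.
Definition tl (v : tree) : tree := if v is Pair _ b then b else Int 0.
Definition is_pair (v : tree) : bool := if v is Pair _ _ then true else false.
Definition truthy (v : tree) : bool := if v is Int z then z != 0 else true.

Definition bitlen (z : int) : nat := (trunc_log 2 `|z|%N).+1.

(* Number of bits (up to a constant factor) needed to write v out in full,
   without sharing of common subtrees. *)
Fixpoint vsize (v : tree) : nat :=
  match v with
  | Int z => bitlen z
  | Pair a b => (vsize a + vsize b).+1
  end.

Definition op_val (o : binop) (a b : int) : int :=
  match o with
  | OAdd => a + b
  | OSub => a - b
  | OMul => a * b
  | ODiv => (a %/ b)%Z
  | OLeq => Posz (a <= b)%R
  end.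

Fixpoint eval (e : expr) (s : store) : tree :=
  match e with
  | Var x => s x
  | Cst z => Int z
  | Cons a b => Pair (eval a s) (eval b s)
  | Hd a => hd (eval a s)
  | Tl a => tl (eval a s)
  | IsPair a => Int (Posz (is_pair (eval a s)))
  | Op o a b => Int (op_val o (int_of (eval a s)) (int_of (eval b s)))
  end.

Fixpoint cost (e : expr) (s : store) : nat :=
  match e with
  | Var _ | Cst _ => 1
  | Hd a | Tl a | IsPair a => (cost a s).+1
  | Cons a b => (cost a s + cost b s).+1
  | Op _ a b => (cost a s + cost b s
      + bitlen (int_of (eval a s)) * bitlen (int_of (eval b s))).+1
  end.

(* [exec O c s s' t]: started in store s, the program c halts in store s'
   after t steps; O i k is the k-digit approximation of the i-th real input. *)
Inductive exec (O : nat -> nat -> int) : com -> store -> store -> nat -> Prop :=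
  | exec_skip s : exec O Skip s s 1
  | exec_assign x e s :
      exec O (Assign x e) s (upd s x (eval e s)) (cost e s).+1
  | exec_get x e1 e2 s i k :
      i = `|int_of (eval e1 s)|%N -> k = `|int_of (eval e2 s)|%N ->
      exec O (Get x e1 e2) s (upd s x (Int (O i k)))
        (cost e1 s + cost e2 s + i + k + bitlen (O i k)).+1
  | exec_seq c1 c2 s s1 s2 t1 t2 :
      exec O c1 s s1 t1 -> exec O c2 s1 s2 t2 ->
      exec O (Seq c1 c2) s s2 (t1 + t2).+1
  | exec_if e c1 c2 s s' t :
      exec O (if truthy (eval e s) then c1 else c2) s s' t ->
      exec O (If e c1 c2) s s' (cost e s + t).+1
  | exec_while_false e c s :
      ~~ truthy (eval e s) -> exec O (While e c) s s (cost e s).+1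
  | exec_while_true e c s s1 s2 t1 t2 :
      truthy (eval e s) -> exec O c s s1 t1 -> exec O (While e c) s1 s2 t2 ->
      exec O (While e c) s s2 (cost e s + t1 + t2).+1.

(* The input is in variable 0 at the start and the output in variable 0 at the
   end; all other variables are initially 0. *)
Definition runs (O : nat -> nat -> int) (c : com) (input output : tree) (t : nat) :=
  exists s', exec O c (upd (fun=> Int 0) 0 input) s' t /\ s' 0%N = output.

Definition real_inputs (R : realType) (xs : seq R) (i k : nat) : int :=
  Num.floor (2%:R ^+ k * xs`_i).

Definition no_reals (i k : nat) : int := 0.

(** * Data formats *)

Definition enc_nat (n : nat) : tree := Int (Posz n).
Definition enc_seq (l : seq tree) : tree := foldr Pair (Int 0) l.
Definition enc_bits (w : seq bool) : tree :=
  enc_seq [seq enc_nat (nat_of_bool b) | b <- w].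

Definition fracv (R : realType) (r : int * int) : R := r.1%:~R / r.2%:~R.
Definition enc_frac (r : int * int) : tree := Pair (Int r.1) (Int r.2).

Definition is_value (R : realType) (v : tree) (x : R) :=
  exists2 r : int * int, 0 < r.2 & v = enc_frac r /\ x = fracv R r.

(* A classical description of q : the list of its values, in the order of the
   enumeration of L, as fractions; trailing zeros may be omitted. *)
Definition describes (R : realType) (L : finType) (w : tree) (q : L -> R) :=
  exists rs : seq (int * int),
    [/\ w = enc_seq [seq enc_frac r | r <- rs],
        (size rs <= #|L|)%N,
        all (fun r : int * int => 0 < r.2) rs &
        forall l : L, q l = fracv R (nth (0, 1) rs (enum_rank l))].

(** * Quantum states and measurements *)

Notation qmatrix R n := 'M[R[i]%C]_(2 ^ n).

Definition psdmx (R : realType) (d : nat) (A : 'M[R[i]%C]_d) :=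
  map_mx Num.conj A^T = A /\
  forall v : 'rV[R[i]%C]_d, 0 <= (v *m A *m map_mx Num.conj v^T) 0 0.

Definition is_state (R : realType) (d : nat) (rho : 'M[R[i]%C]_d) :=
  psdmx rho /\ \tr rho = 1.

(* First elements E of the two-outcome POVMs {E, 1 - E}. *)
Definition is_effect (R : realType) (d : nat) (E : 'M[R[i]%C]_d) :=
  psdmx E /\ psdmx (1%:M - E).

Definition poly_descriptions (R : realType) (M : forall n, set (qmatrix R n))
    (desc : forall n, qmatrix R n -> seq bool) :=
  (forall n E E', M n E -> M n E' -> desc n E = desc n E' -> E = E') /\
  exists c : nat, forall n E, M n E -> (size (desc n E) <= c * n.+1 ^ c)%N.

(** * Ontological models *)

Definition preparation (R : realType) (L : finType) (p : L -> R) :=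
  (forall l, 0 <= p l) /\ \sum_l p l = 1.

Definition response (R : realType) (L : finType) (S : Type)
    (p : L -> R) (f : L -> S -> R) (E : S) : R := \sum_l p l * f l E.

Record ontological_model (R : realType) (n : nat) (C M : set (qmatrix R n))
    (L : finType) (f : L -> qmatrix R n -> R) (p : qmatrix R n -> L -> R) : Prop := {
  om_outcome : forall l E, M E -> 0 <= f l E <= 1;
  om_prep : forall rho, C rho -> preparation (p rho);
  om_born : forall rho E, C rho -> M E ->
    \tr (rho *m E) = (response (p rho) f E)%:C%C
}.

(* Evaluating a number means outputting it exactly, as a fraction.  Algorithms
   are uniform in n; the ontic state l is given to them by its index
   [enum_rank l], and states and measurements by their descriptions. *)
Record efficient_ontological_model (R : realType)
    (C M : forall n, set (qmatrix R n))
    (cdesc mdesc : forall n, qmatrix R n -> seq bool)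
    (L : nat -> finType) (f : forall n, L n -> qmatrix R n -> R)
    (p : forall n, qmatrix R n -> L n -> R) : Prop := {
  eom_model : forall n, ontological_model (C n) (M n) (@f n) (@p n);
  eom_size : exists c : nat, forall n, (#|L n| <= c * n.+1 ^ c)%N;
  eom_outcome : exists (a : com) (c : nat), forall n l E, M n E ->
    exists v t,
      [/\ runs no_reals a
            (enc_seq [:: enc_nat n; enc_nat (enum_rank l); enc_bits (mdesc n E)])
            v t,
          is_value v (f n l E) & (t <= c * n.+1 ^ c)%N];
  eom_prep : exists (a : com) (c : nat), forall n l rho, C n rho ->
    exists v t,
      [/\ runs no_reals a
            (enc_seq [:: enc_nat n; enc_nat (enum_rank l); enc_bits (cdesc n rho)])
            v t,
          is_value v (p n rho l) & (t <= c * n.+1 ^ c)%N]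
}.

(** * Learning *)

Definition training_set (R : realType) (n : nat) (M : set (qmatrix R n))
    (L : finType) (f : L -> qmatrix R n -> R) (p : L -> R)
    (T : seq (qmatrix R n * R)) :=
  forall Ed, Ed \in T -> M Ed.1 /\ Ed.2 = response p f Ed.1.

(* One run of the learner: its finite input is n and the descriptions of the
   E_i; its real inputs are 1/eta, d_1, ..., d_m. *)
Definition learner_run (R : realType) (mdesc : forall n, qmatrix R n -> seq bool)
    (L1 : com) (n : nat) (eta : R) (T : seq (qmatrix R n * R)) (w : tree) (t : nat) :=
  runs (real_inputs (eta^-1 :: [seq Ed.2 | Ed <- T])) L1
    (enc_seq [:: enc_nat n; enc_seq [seq enc_bits (mdesc n Ed.1) | Ed <- T]]) w t.

(* Main.v *)
(* Learner.  Let P = 2^k >= 8 / eta, and round the outcome probabilities and the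
   data to the integers g_i(l) = floor(P f(l,E_i)) and y_i = floor(P d_i).  For a
   guessed number s of ontic states, the learner looks for integer weights x >= 0 on
   the first s states with |sum_l x_l g_i(l) - D y_i| <= 2 D for all i, where
   D = s P^2; normalization is one more such constraint, with g = y = P.  Starting
   from x = 0, it replaces x by max(x +- g_i, 0) for some violated i.  If s = |L|, the
   true preparation p satisfies all constraints, up to rounding, and each step lowers
   |x - D p|^2, which is at most D^2 at the start, by more than D.  So if D steps do
   not suffice, then s < |L|, and s can be increased: although |L| is not computable,
   no state outside L is ever used.  The output is x divided by its sum.

   Predictor.  It adds up the fractions q(l) f(l,E) over the states listed in q. *)

Require Import Defs.
From mathcomp Require Import all_boot all_order all_algebra.
From mathcomp Require Import complex.
From mathcomp Require Import classical_sets reals.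
From mathcomp Require Import zify ring lra.

Set Implicit Arguments.
Unset Strict Implicit.
Unset Printing Implicit Defensive.

Import Order.TTheory GRing.Theory Num.Theory.
Local Open Scope ring_scope.

(** The constants come from one balance. The point D p misses each rounded constraint by at most D,
    half the tolerance 2 D, so a violated constraint contributes a linear term below - 2 D to the
    change of |x - D p|^2; the quadratic term is at most s P^2, and D is chosen equal to it. A start
    at D^2 thus leaves no room for a D-th step. The potential contains the unknown p and lives only
    in the proof; the program carries a step counter. Normalization holds only up to D / 4, so the
    output is divided by its own sum and not by D. The other obstacle is cost: f is known only as an
    unspecified program with a time bound. One number b bounds the times of its calls, the rounds of
    every loop and all bit lengths at once; the weight of a program then turns b into a running
    time, and it remains to show that b is polynomial. The claim about L2 concerns any run of the
    learner and any function described by its output, so it rests on determinism and on the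
    description alone. *)

(** * Bit lengths of integers and the cost of expressions *)

Lemma bitlen_gt0 z : (0 < bitlen z)%N. Proof. by []. Qed.

Lemma ltn_bitlen z : (`|z|%N < 2 ^ bitlen z)%N.
Proof. by rewrite /bitlen trunc_log_ltn. Qed.

Lemma bitlen_leq z k : (0 < k)%N -> (`|z|%N < 2 ^ k)%N -> (bitlen z <= k)%N.
Proof.
move=> k0 zk; rewrite /bitlen; case: (posnP `|z|%N) => [->|z0].
  by rewrite trunc_log0.
by rewrite -(ltn_exp2l _ _ (isT : (1 < 2)%N)) (leq_ltn_trans _ zk) // trunc_logP.
Qed.

Lemma bitlen_leq_abs z b : (`|z|%N < b)%N -> (bitlen z <= b)%N.
Proof.
move=> zb; apply: bitlen_leq; first lia.
by apply: (leq_trans zb); rewrite ltnW // ltn_expl.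
Qed.

Lemma leq_bitlen x y : (`|x| <= `|y|)%N -> (bitlen x <= bitlen y)%N.
Proof. by move=> xy; apply: bitlen_leq => //; apply: leq_ltn_trans (ltn_bitlen y). Qed.

Lemma bitlenD x y : (bitlen (x + y)%R <= bitlen x + bitlen y)%N.
Proof.
apply: bitlen_leq => //.
have := ltn_bitlen x; have := ltn_bitlen y; rewrite expnD.
have := bitlen_gt0 x; have := bitlen_gt0 y.
case: (bitlen y) => [//|j] _; case: (bitlen x) => [//|i] _; rewrite !expnS.
have := expn_gt0 2 i; have := expn_gt0 2 j; rewrite /=.
set a := (2 ^ i)%N; set c := (2 ^ j)%N => c0 a0 hy hx.
have -> : (2 * a * (2 * c) = 4 * (a * c))%N by lia.
have : (a + c <= 2 * (a * c))%N by nia.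
lia.
Qed.

Lemma bitlenN x : bitlen (- x)%R = bitlen x.
Proof. by rewrite /bitlen abszN. Qed.

Lemma bitlenM x y : (bitlen (x * y)%R <= bitlen x + bitlen y)%N.
Proof.
apply: bitlen_leq => //; rewrite abszM expnD.
by apply: ltn_mul; apply: ltn_bitlen.
Qed.

Lemma absz_divz x y : (`|(x %/ y)%Z| <= `|x|)%N.
Proof. by have := @lez_div x y; lia. Qed.

Lemma bitlen_op o x y : (bitlen (op_val o x y) <= bitlen x + bitlen y)%N.
Proof.
case: o => /=.
- exact: bitlenD.
- by rewrite -(bitlenN y) bitlenD.
- exact: bitlenM.
- by apply: leq_trans (leq_addr _ _); apply: leq_bitlen; apply: absz_divz.
- by apply: leq_trans (leq_addr _ _); case: (x <= y).
Qed.

(** The maximum over the leaves and not the total size: sharing lets [Cons] double the written-out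
    tree at unit cost, whereas the price of an operation depends only on the lengths of the integers
    it reads. *)
Fixpoint tbits (v : tree) : nat :=
  match v with Int z => bitlen z | Pair a b => maxn (tbits a) (tbits b) end.

Lemma tbits_gt0 v : (0 < tbits v)%N.
Proof. by elim: v => //= a ha b hb; rewrite leq_max ha. Qed.

Lemma tbits_hd v : (tbits (hd v) <= tbits v)%N.
Proof. by case: v => //= *; rewrite leq_maxl. Qed.

Lemma tbits_tl v : (tbits (tl v) <= tbits v)%N.
Proof. by case: v => //= *; rewrite leq_maxr. Qed.

Lemma tbits_int_of v : (bitlen (int_of v) <= tbits v)%N.
Proof. by case: v => //= *; rewrite leq_max tbits_gt0. Qed.

Fixpoint esize (e : expr) : nat :=
  match e with
  | Var _ => 1
  | Cst z => bitlen z
  | Defs.Cons a b | Op _ a b => (esize a + esize b).+1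
  | Hd a | Tl a | IsPair a => (esize a).+1
  end.

Lemma esize_gt0 e : (0 < esize e)%N. Proof. by case: e. Qed.

Section Bits.
Variables (b : nat) (s : store).
Hypotheses (b0 : (0 < b)%N) (sb : forall x, (tbits (s x) <= b)%N).

Lemma tbits_eval e : (tbits (eval e s) <= esize e * b)%N.
Proof.
have up m u v : (m <= u * b -> u <= v -> m <= v * b)%N.
  by move=> h uv; apply: leq_trans h _; rewrite leq_mul2r uv orbT.
elim: e => [x|z|x hx y hy|x hx|x hx|x hx|o x hx y hy] /=.
- by rewrite mul1n.
- by rewrite leq_pmulr.
- by rewrite geq_max; apply/andP; split; [apply: up hx _|apply: up hy _]; lia.
- by apply: leq_trans (tbits_hd _) _; apply: up hx _.
- by apply: leq_trans (tbits_tl _) _; apply: up hx _.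
- by case: is_pair => /=; rewrite muln_gt0.
- apply: leq_trans (bitlen_op _ _ _) _; apply: (@up _ (esize x + esize y)%N) => //.
  by rewrite mulnDl leq_add // (leq_trans (tbits_int_of _)).
Qed.

(** Subexpressions have values of at most [esize * b] bits, so an operation, charged the product of
    two lengths, costs a multiple of b^2; the cube leaves room for the sum over subexpressions. *)
Lemma cost_leq e : (cost e s <= esize e ^ 3 * b ^ 2)%N.
Proof.
have b2 : (0 < b ^ 2)%N by rewrite expn_gt0 b0.
have step m n : (m <= n ^ 3 * b ^ 2 -> m.+1 <= n.+1 ^ 3 * b ^ 2)%N.
  move=> h; rewrite -addn1; apply: (@leq_trans (n ^ 3 * b ^ 2 + b ^ 2)); first lia.
  by rewrite -[X in (_ + X)%N]mul1n -mulnDl leq_mul2r; apply/orP; right; nia.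
elim: e => [x|z|x hx y hy|x hx|x hx|x hx|o x hx y hy] /=; try exact: step.
- apply: step; apply: leq_trans (leq_add hx hy) _.
  by rewrite -mulnDl leq_mul2r; apply/orP; right; nia.
- have lx := leq_trans (tbits_int_of _) (tbits_eval x).
  have ly := leq_trans (tbits_int_of _) (tbits_eval y).
  have := leq_mul lx ly; rewrite mulnACA -[(b * b)%N]/(b ^ 2)%N => l.
  move: (esize_gt0 x) (esize_gt0 y) hx hy l b2.
  set u := esize x; set v := esize y; set B := (b ^ 2)%N.
  move: (cost x s) (cost y s) => p q u0 v0 hp hq hl B0.
  have -> : ((u + v).+1 ^ 3 = u ^ 3 + v ^ 3 + u * v + 1 +
      (3 * u * u * v + 3 * u * v * v + 3 * u * u + 3 * v * v + 3 * u + 3 * v + 5 * u * v))%N.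
    by rewrite -addn1; ring.
  apply: leq_trans (leq_mul (leq_addr _ _) (leqnn _)).
  by rewrite !mulnDl mul1n -addn1 !leq_add.
Qed.

End Bits.

(** * Locality and determinism of execution *)

Fixpoint evars (e : expr) : nat :=
  match e with
  | Var x => x.+1
  | Cst _ => 0
  | Defs.Cons a b | Op _ a b => maxn (evars a) (evars b)
  | Hd a | Tl a | IsPair a => evars a
  end.

Lemma eq_eval e (s u : store) : (forall x, (x < evars e)%N -> s x = u x) ->
  eval e s = eval e u /\ cost e s = cost e u.
Proof.
elim: e => [x|z|x hx y hy|x hx|x hx|x hx|o x hx y hy] //= h.
- by rewrite h.
- have [] : eval x s = eval x u /\ cost x s = cost x u.
    by apply: hx => k kx; apply: h; rewrite leq_max kx.
  have [] : eval y s = eval y u /\ cost y s = cost y u.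
    by apply: hy => k kx; apply: h; rewrite leq_max kx orbT.
  by move=> -> -> -> ->.
- by have [-> ->] := hx h.
- by have [-> ->] := hx h.
- by have [-> ->] := hx h.
- have [] : eval x s = eval x u /\ cost x s = cost x u.
    by apply: hx => k kx; apply: h; rewrite leq_max kx.
  have [] : eval y s = eval y u /\ cost y s = cost y u.
    by apply: hy => k kx; apply: h; rewrite leq_max kx orbT.
  by move=> -> -> -> ->.
Qed.

Fixpoint cvars (c : com) : nat :=
  match c with
  | Skip => 0
  | Assign x e => maxn x.+1 (evars e)
  | Get x e1 e2 => maxn x.+1 (maxn (evars e1) (evars e2))
  | Defs.Seq c1 c2 => maxn (cvars c1) (cvars c2)
  | If e c1 c2 => maxn (evars e) (maxn (cvars c1) (cvars c2))
  | While e c => maxn (evars e) (cvars c)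
  end.

(** The predictor must handle the output of an arbitrary run of the learner; determinism identifies
    it with the run whose output is known to be short. *)
Lemma exec_det O c s s1 s2 t1 t2 :
  exec O c s s1 t1 -> exec O c s s2 t2 -> s1 = s2 /\ t1 = t2.
Proof.
move=> h; elim: h s2 t2 => {c s s1 t1}.
- by move=> s s2 t2 h; inversion h.
- by move=> x e s s2 t2 h; inversion h.
- by move=> x e1 e2 s i k -> -> s2 t2 h; inversion h; subst.
- move=> c1 c2 s s1 s2 t1 t2 _ h1 _ h2 s3 t3 h; inversion h; subst.
  by edestruct h1; [eassumption|subst]; edestruct h2; [eassumption|subst].
- move=> e c1 c2 s s' t _ h1 s3 t3 h; inversion h; subst.
  by edestruct h1; [eassumption|subst].
- move=> e c s h s3 t3 h'; inversion h' as [| | | | |? ? ? h0|? ? ? ? ? ? ? h0]; subst => //.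
  by rewrite h0 in h.
- move=> e c s s1 s2 t1 t2 h0 _ h1 _ h2 s3 t3 h.
  inversion h as [| | | | |? ? ? h0'|]; subst.
    by rewrite h0 in h0'.
  by edestruct h1; [eassumption|subst]; edestruct h2; [eassumption|subst].
Qed.

(** * Subroutine calls *)

Fixpoint shift_expr (K : nat) (e : expr) : expr :=
  match e with
  | Var x => Var (K + x)
  | Cst z => Cst z
  | Defs.Cons a b => Defs.Cons (shift_expr K a) (shift_expr K b)
  | Hd a => Hd (shift_expr K a)
  | Tl a => Tl (shift_expr K a)
  | IsPair a => IsPair (shift_expr K a)
  | Op o a b => Op o (shift_expr K a) (shift_expr K b)
  end.

(* Without real inputs, [Get] always reads 0. *)
Fixpoint shift_com (K : nat) (c : com) : com :=
  match c with
  | Skip => Skip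
  | Assign x e => Assign (K + x) (shift_expr K e)
  | Get x _ _ => Assign (K + x) (Cst 0)
  | Defs.Seq c1 c2 => Defs.Seq (shift_com K c1) (shift_com K c2)
  | If e c1 c2 => If (shift_expr K e) (shift_com K c1) (shift_com K c2)
  | While e c => While (shift_expr K e) (shift_com K c)
  end.

Lemma eval_shift K m e (s u : store) : (evars e <= m)%N ->
  (forall x, (x < m)%N -> u (K + x)%N = s x) ->
  eval (shift_expr K e) u = eval e s /\ cost (shift_expr K e) u = cost e s.
Proof.
move=> + h; elim: e => [x|z|x hx y hy|x hx|x hx|x hx|o x hx y hy] //=;
  rewrite ?geq_max.
- by move=> xm; rewrite h.
- by case/andP => /hx [-> ->] /hy [-> ->].
- by move=> /hx [-> ->].
- by move=> /hx [-> ->].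
- by move=> /hx [-> ->].
- by case/andP => /hx [-> ->] /hy [-> ->].
Qed.

Lemma cost_gt0 e s : (0 < cost e s)%N. Proof. by case: e. Qed.

(** The renamed program works in the variables from K on, so the caller's variables below K survive.
    The time is bounded and not preserved, because [Get] became a cheaper assignment. *)
Lemma exec_shift O K m c s s1 t : exec no_reals c s s1 t ->
  (cvars c <= m)%N ->
  forall u, (forall x, (x < m)%N -> u (K + x)%N = s x) ->
  exists u1 t1, [/\ exec O (shift_com K c) u u1 t1, (t1 <= t)%N,
    forall x, (x < m)%N -> u1 (K + x)%N = s1 x &
    forall y, (y < K)%N -> u1 y = u y].
Proof.
have updK u x v z : (z < K)%N -> upd u (K + x)%N v z = u z.
  by move=> zK; rewrite /upd; case: eqP => // E; lia.
have updm u s' x v z : (z < m)%N -> u (K + z)%N = s' z ->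
    upd u (K + x)%N v (K + z)%N = upd s' x v z.
  by move=> zm h; rewrite /upd eqn_add2l; case: eqP.
elim=> {c s s1 t} /=.
- by move=> s _ u h; exists u, 1%N; split=> //; constructor.
- move=> x e s; rewrite geq_max => /andP[xm em] u h.
  have [<- <-] := eval_shift em h.
  eexists _, _; split; first exact: exec_assign; first by [].
    by move=> z zm; apply: updm => //; apply: h.
  by move=> y; apply: updK.
- move=> x e1 e2 s i k _ _; rewrite geq_max => /andP[xm em] u h.
  eexists _, _; split; first exact: exec_assign.
  + by have := cost_gt0 e1 s; have := cost_gt0 e2 s => /=; lia.
  + by move=> z zm; apply: updm => //; apply: h.
  + by move=> y; apply: updK.
- move=> c1 c2 s s1 s2 t1 t2 _ h1 _ h2; rewrite geq_max => /andP[m1 m2] u h.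
  have [u1 [t1' [e1 l1 a1 f1]]] := h1 m1 u h.
  have [u2 [t2' [e2 l2 a2 f2]]] := h2 m2 u1 a1.
  exists u2, (t1' + t2').+1; split=> //; first exact: exec_seq e1 e2; first lia.
  by move=> y yK; rewrite f2 // f1.
- move=> e c1 c2 s s1 t _ h1; rewrite !geq_max => /andP[em /andP[m1 m2]] u h.
  have [E1 E2] := eval_shift em h.
  have [|u1 [t1 [e1 l1 a1 f1]]] := h1 _ u h; first by case: ifP.
  exists u1, (cost e s + t1).+1; split=> //; last by lia.
  by rewrite -E2; apply: exec_if; rewrite E1; case: ifP e1.
- move=> e c s h0; rewrite geq_max => /andP[em m1] u h.
  have [E1 E2] := eval_shift em h.
  by exists u, (cost e s).+1; split=> //; rewrite -E2; apply: exec_while_false; rewrite E1.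
- move=> e c s s1 s2 t1 t2 h0 _ h1 _ h2 /[dup] cm; rewrite geq_max => /andP[em m1] u h.
  have [E1 E2] := eval_shift em h.
  have [u1 [t1' [e1 l1 a1 f1]]] := h1 m1 u h.
  have [u2 [t2' [e2 l2 a2 f2]]] := h2 cm u1 a1.
  exists u2, (cost e s + t1' + t2').+1; split=> //.
  + by rewrite -E2; apply: exec_while_true e1 e2; rewrite E1.
  + by lia.
  + by move=> y yK; rewrite f2 // f1.
Qed.

Fixpoint ebits (e : expr) : nat :=
  match e with
  | Var _ => 0
  | Cst z => bitlen z
  | Defs.Cons a b | Op _ a b => maxn (ebits a) (ebits b)
  | Hd a | Tl a | IsPair a => ebits a
  end.

Fixpoint cbits (c : com) : nat :=
  match c with
  | Skip | Get _ _ _ => 0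
  | Assign _ e => ebits e
  | Defs.Seq c1 c2 | If _ c1 c2 => maxn (cbits c1) (cbits c2)
  | While _ c => cbits c
  end.

(* Multiplication is charged the product of the operand lengths, which exceeds
   the length of the result by at most one. *)
Lemma tbits_eval_cost b e s : (ebits e <= b)%N -> (cost e s <= b)%N ->
  (forall x, (tbits (s x) <= b)%N) -> (tbits (eval e s) <= b)%N.
Proof.
move=> + + sb; elim: e => [x|z|x hx y hy|x hx|x hx|x hx|o x hx y hy] //=;
  rewrite ?geq_max.
- by move=> /andP[bx cb] cc; rewrite hx ?hy //; lia.
- by move=> hb cc; apply: leq_trans (tbits_hd _) _; apply: hx => //; lia.
- by move=> hb cc; apply: leq_trans (tbits_tl _) _; apply: hx => //; lia.
- by move=> _; apply: leq_trans; case: is_pair.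
- move=> _; apply: leq_trans; apply: leq_trans (bitlen_op _ _ _) _.
  by rewrite /bitlen mulSn mulnS; lia.
Qed.

(** Every number created is paid for by the operation that creates it, so b bits suffice once b
    bounds the time, the constants and the initial store. This converts the time bound for the
    unknown program of f into a size bound for its answers. *)
Lemma tbits_exec b c s s1 t : exec no_reals c s s1 t ->
  (cbits c <= b)%N -> (t <= b)%N -> (forall x, (tbits (s x) <= b)%N) ->
  forall x, (tbits (s1 x) <= b)%N.
Proof.
have updb u x v : (tbits v <= b)%N -> (forall x, (tbits (u x) <= b)%N) ->
    forall y, (tbits (upd u x v y) <= b)%N.
  by move=> vb ub y; rewrite /upd; case: ifP.
elim=> {c s s1 t} //=.
- by move=> x e s cb tb sb; apply: updb => //; apply: tbits_eval_cost => //; lia.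
- by move=> x e1 e2 s i k _ _ _ tb sb; apply: updb => //=; lia.
- move=> c1 c2 s s1 s2 t1 t2 _ h1 _ h2; rewrite geq_max => /andP[b1 b2] tb sb.
  by apply: h2 => //; [lia|apply: h1 => //; lia].
- move=> e c1 c2 s s1 t _ h; rewrite geq_max => /andP[b1 b2] tb sb.
  by apply: h => //; [case: ifP|lia].
- move=> e c s s1 s2 t1 t2 h0 _ h1 _ h2 cb tb sb.
  by apply: h2 => //; [lia|apply: h1 => //; lia].
Qed.

(** * Total correctness with time bounds *)

(* All running times are bounded by [weight c * b ^ weight c], where b bounds
   the bit length of every number held and the number of rounds of each loop. *)
Fixpoint weight (c : com) : nat :=
  match c with
  | Skip => 1
  | Assign _ e => esize e ^ 3 + 2
  | Get _ e1 e2 => esize e1 ^ 3 + esize e2 ^ 3 + 4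
  | Defs.Seq c1 c2 => (weight c1 + weight c2).+1
  | If e c1 c2 => esize e ^ 3 + weight c1 + weight c2 + 2
  | While e c => 2 * (esize e ^ 3 + weight c + 3)
  end.

Lemma weight_gt0 c : (0 < weight c)%N.
Proof. by case: c => [|x e|x e1 e2|c1 c2|e c1 c2|e c] //=; lia. Qed.

Lemma leq_mono b i j k : (0 < b)%N -> (i <= k)%N -> (j <= k)%N ->
  (i * b ^ j <= k * b ^ k)%N.
Proof. by move=> b0 ik jk; rewrite leq_mul // leq_pexp2l. Qed.

Section Wp.
Variables (b : nat) (O : nat -> nat -> int).
Hypothesis b0 : (0 < b)%N.

Definition timely (c : com) (s s' : store) :=
  exists2 t, exec O c s s' t & (t <= weight c * b ^ weight c)%N.

Lemma timely_skip s : timely Skip s s.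
Proof. by exists 1%N; [constructor|rewrite /= mul1n expn1]. Qed.

Lemma timely_assign x e s : (cost e s <= esize e ^ 3 * b ^ 2)%N ->
  timely (Assign x e) s (upd s x (eval e s)).
Proof.
move=> h; exists (cost e s).+1; first exact: exec_assign.
rewrite /=; set w := (_ + 2)%N.
apply: (@leq_trans ((esize e ^ 3 + 1) * b ^ 2)); last by apply: leq_mono; lia.
by rewrite mulnDl mul1n -addn1 leq_add // expn_gt0 b0.
Qed.

Lemma timely_seq c1 c2 s s1 s2 : timely c1 s s1 -> timely c2 s1 s2 ->
  timely (Defs.Seq c1 c2) s s2.
Proof.
move=> [t1 h1 l1] [t2 h2 l2]; exists (t1 + t2).+1; first exact: exec_seq h1 h2.
move: l1 l2 => /=; set w1 := weight c1; set w2 := weight c2 => l1 l2.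
set w := (w1 + w2).+1.
have -> : (w * b ^ w = w1 * b ^ w + w2 * b ^ w + b ^ w)%N by rewrite -!mulnDl mulSn addnC.
rewrite -addn1 !leq_add ?expn_gt0 ?b0 //.
  by apply: leq_trans l1 _; rewrite leq_mul // leq_pexp2l // /w; lia.
by apply: leq_trans l2 _; rewrite leq_mul // leq_pexp2l // /w; lia.
Qed.

Lemma timely_get x e1 e2 s i k :
  `|int_of (eval e1 s)|%N = i -> `|int_of (eval e2 s)|%N = k ->
  (cost e1 s <= esize e1 ^ 3 * b ^ 2)%N -> (cost e2 s <= esize e2 ^ 3 * b ^ 2)%N ->
  (i <= b)%N -> (k <= b)%N -> (bitlen (O i k) <= b)%N ->
  timely (Get x e1 e2) s (upd s x (Int (O i k))).
Proof.
move=> hi hk h1 h2 ib kb ob; eexists; first by apply: exec_get; symmetry; eassumption.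
rewrite /=; set w := (_ + 4)%N.
apply: (@leq_trans (w * b ^ 2)); last by apply: leq_mono; lia.
have b2 : (b <= b ^ 2)%N by rewrite -[X in (X <= _)%N]expn1 leq_pexp2l.
rewrite /w !mulnDl; lia.
Qed.

Lemma timely_if e c1 c2 s s' : (cost e s <= esize e ^ 3 * b ^ 2)%N ->
  timely (if truthy (eval e s) then c1 else c2) s s' -> timely (If e c1 c2) s s'.
Proof.
move=> h [t ht lt]; exists (cost e s + t).+1; first exact: exec_if.
rewrite /=; set w := (_ + 2)%N.
have -> : (w * b ^ w = esize e ^ 3 * b ^ w + (weight c1 + weight c2) * b ^ w + 2 * b ^ w)%N.
  by rewrite -!mulnDl /w; congr (_ * _)%N; lia.
have p k : (k <= w -> b ^ k <= b ^ w)%N by move=> ?; rewrite leq_pexp2l.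
have : (cost e s <= esize e ^ 3 * b ^ w)%N.
  by apply: leq_trans h _; rewrite leq_mul // p // /w; lia.
have : (t <= (weight c1 + weight c2) * b ^ w)%N.
  by apply: leq_trans lt _; case: ifP => _; rewrite leq_mul ?p // /w; lia.
have : (0 < b ^ w)%N by rewrite expn_gt0 b0.
lia.
Qed.

(** The index i is a strictly decreasing variant, so there are at most b rounds and the loop costs
    at most 2 b times the bound W for one round; the doubled weight pays for this. *)
Lemma timely_while (I : nat -> store -> Prop) e c s i :
  (forall i s, I i s -> (cost e s <= esize e ^ 3 * b ^ 2)%N) ->
  (forall i s, I i s -> truthy (eval e s) ->
     exists s' j, [/\ timely c s s', (j < i)%N & I j s']) ->
  (i <= b)%N -> I i s ->
  exists s' j, [/\ timely (While e c) s s', I j s' & ~~ truthy (eval e s')].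
Proof.
move=> hc step ib; set W := (esize e ^ 3 * b ^ 2 + weight c * b ^ weight c + 1)%N.
suff H : I i s -> exists s' j t, [/\ exec O (While e c) s s' t, (t <= i.+1 * W)%N,
    I j s' & ~~ truthy (eval e s')].
  move=> /H [s' [j [t [h lt Ij ne]]]]; exists s', j; split=> //; exists t => //.
  apply: leq_trans lt _; rewrite /=; set w := (2 * _)%N.
  apply: (@leq_trans ((2 * b) * W)); first by rewrite leq_mul //; lia.
  set k := (esize e ^ 3 + weight c + 2)%N.
  have hW : (W <= k * b ^ k)%N.
    have p j0 : (j0 <= k -> b ^ j0 <= b ^ k)%N by move=> ?; rewrite leq_pexp2l.
    have : (0 < b ^ k)%N by rewrite expn_gt0 b0.
    have : (esize e ^ 3 * b ^ 2 <= esize e ^ 3 * b ^ k)%N by rewrite leq_mul // p // /k; lia.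
    have : (weight c * b ^ weight c <= weight c * b ^ k)%N by rewrite leq_mul // p // /k; lia.
    have -> : (k * b ^ k = esize e ^ 3 * b ^ k + weight c * b ^ k + 2 * b ^ k)%N.
      by rewrite -!mulnDl.
    by rewrite /W; lia.
  apply: leq_trans (leq_mul (leqnn _) hW) _.
  have -> : (2 * b * (k * b ^ k) = 2 * k * b ^ k.+1)%N by rewrite expnS; ring.
  by apply: leq_mono => //; rewrite /w /k; lia.
move: s {ib}; elim/ltn_ind: i => i IH s Is.
have hcs := hc _ _ Is.
case: (boolP (truthy (eval e s))) => [te|ne]; last first.
  exists s, i, (cost e s).+1; split=> //; first exact: exec_while_false.
  by rewrite mulSn /W; lia.
have [s1 [j [[t1 h1 l1] ji Ij]]] := step _ _ Is te.
have [s2 [j2 [t2 [h2 l2 I2 n2]]]] := IH _ ji _ Ij.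
exists s2, j2, (cost e s + t1 + t2).+1; split=> //; first exact: exec_while_true h1 h2.
rewrite mulSn; have : (j.+1 * W <= i * W)%N by rewrite leq_mul.
by rewrite {2}/W; lia.
Qed.

Definition st (l : seq tree) : store := nth (Int 0) l.

Definition agree (l : seq tree) (s : store) :=
  forall x, (x < size l)%N -> s x = st l x.

Definition bounded (l : seq tree) := all (fun v => (tbits v <= b)%N) l.

(* The list l holds the values of the variables 0, .., size l - 1; the remaining
   variables are scratch space for subroutine calls. *)
Definition wp (c : com) (l : seq tree) (Q : seq tree -> Prop) :=
  bounded l -> forall s, agree l s ->
  exists s' l', [/\ timely c s s', agree l' s', bounded l' & Q l'].

Lemma tbits_st l x : bounded l -> (tbits (st l x) <= b)%N.
Proof.
move=> /(all_nthP (Int 0)) lb; rewrite /st; case: (ltnP x (size l)) => xl.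
  exact: lb.
by rewrite nth_default.
Qed.

Lemma eval_agree l s e : agree l s -> bounded l -> (evars e <= size l)%N ->
  eval e s = eval e (st l) /\ (cost e s <= esize e ^ 3 * b ^ 2)%N.
Proof.
move=> ls lb el; have [|-> ->] := @eq_eval e s (st l).
  by move=> x xe; apply: ls; apply: leq_trans el.
by split=> //; apply: cost_leq => // x; apply: tbits_st.
Qed.

Lemma agree_upd l s x v : agree l s -> (x < size l)%N ->
  agree (set_nth (Int 0) l x v) (upd s x v).
Proof.
move=> ls xl y; rewrite size_set_nth (maxn_idPr xl) => yl.
by rewrite /upd /st nth_set_nth /=; case: eqP => // _; apply: ls.
Qed.

Lemma bounded_upd l x v : bounded l -> (tbits v <= b)%N ->
  bounded (set_nth (Int 0) l x v).
Proof.
move=> lb vb; apply/(all_nthP (Int 0)) => i _.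
by rewrite nth_set_nth /=; case: eqP => // _; apply: tbits_st.
Qed.

Lemma wp_weaken c l (Q Q' : seq tree -> Prop) :
  (forall l, Q l -> Q' l) -> wp c l Q -> wp c l Q'.
Proof.
move=> QQ h lb s ls; have [s' [l' [h1 h2 h3 h4]]] := h lb s ls.
by exists s', l'; split=> //; apply: QQ.
Qed.

Lemma wp_assign x e l (Q : seq tree -> Prop) :
  (x < size l)%N -> (evars e <= size l)%N ->
  (bounded l -> (tbits (eval e (st l)) <= b)%N) ->
  Q (set_nth (Int 0) l x (eval e (st l))) ->
  wp (Assign x e) l Q.
Proof.
move=> xl el vb Ql lb s ls; have [E ce] := eval_agree ls lb el.
exists (upd s x (eval e s)), (set_nth (Int 0) l x (eval e (st l))).
split=> //; first exact: timely_assign.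
- by rewrite E; apply: agree_upd.
- by apply: bounded_upd => //; apply: vb.
Qed.

(** Such an expression produces no leaf longer than those already in the store, so assigning it
    raises no bit-length condition. *)
Fixpoint opfree (e : expr) : bool :=
  match e with
  | Var _ => true
  | Cst z => (`|z| <= 1)%N
  | Defs.Cons a b => opfree a && opfree b
  | Hd a | Tl a | IsPair a => opfree a
  | Op _ _ _ => false
  end.

Lemma tbits_opfree e l : opfree e -> bounded l -> (tbits (eval e (st l)) <= b)%N.
Proof.
move=> + lb; elim: e => [x|z|x hx y hy|x hx|x hx|x hx|o x hx y hy] //=.
- by move=> _; apply: tbits_st.
- by move=> z1; apply: leq_trans b0; apply: bitlen_leq => //; rewrite expn1 ltnS.
- by case/andP => ox oy; rewrite geq_max hx ?hy.
- by move=> ox; apply: leq_trans (tbits_hd _) (hx ox).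
- by move=> ox; apply: leq_trans (tbits_tl _) (hx ox).
- by move=> _; apply: leq_trans b0; case: is_pair.
Qed.

Lemma wp_move x e l (Q : seq tree -> Prop) :
  [&& opfree e, x < size l & evars e <= size l]%N ->
  Q (set_nth (Int 0) l x (eval e (st l))) -> wp (Assign x e) l Q.
Proof.
by case/and3P=> oe xl el; apply: wp_assign => // lb; apply: tbits_opfree.
Qed.

Lemma wp_get x e1 e2 l (Q : seq tree -> Prop) i k :
  [&& x < size l, evars e1 <= size l & evars e2 <= size l]%N ->
  `|int_of (eval e1 (st l))|%N = i -> `|int_of (eval e2 (st l))|%N = k ->
  (i <= b)%N -> (k <= b)%N -> (bitlen (O i k) <= b)%N ->
  Q (set_nth (Int 0) l x (Int (O i k))) -> wp (Get x e1 e2) l Q.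
Proof.
move=> /and3P[xl l1 l2] hi hk ib kb ob Ql lb s ls.
have [E1 c1] := eval_agree ls lb l1; have [E2 c2] := eval_agree ls lb l2.
exists (upd s x (Int (O i k))), (set_nth (Int 0) l x (Int (O i k))).
split=> //; first by apply: timely_get; rewrite ?E1 ?E2.
- exact: agree_upd.
- exact: bounded_upd.
Qed.

Lemma wp_seq c1 c2 l (Q : seq tree -> Prop) :
  wp c1 l (fun l1 => wp c2 l1 Q) -> wp (Defs.Seq c1 c2) l Q.
Proof.
move=> h lb s ls; have [s1 [l1 [h1 a1 b1 q1]]] := h lb s ls.
have [s2 [l2 [h2 a2 b2 q2]]] := q1 b1 s1 a1.
by exists s2, l2; split=> //; apply: timely_seq h1 h2.
Qed.

Lemma wp_if e c1 c2 l (Q : seq tree -> Prop) : (evars e <= size l)%N ->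
  (truthy (eval e (st l)) -> wp c1 l Q) ->
  (~~ truthy (eval e (st l)) -> wp c2 l Q) -> wp (If e c1 c2) l Q.
Proof.
move=> el h1 h2 lb s ls; have [E ce] := eval_agree ls lb el.
have [|s' [l' [t' a' b' q']]] :=
  (_ : wp (if truthy (eval e (st l)) then c1 else c2) l Q) lb s ls.
  by case: ifP => [/h1|/negbT/h2].
by exists s', l'; split=> //; apply: timely_if => //; rewrite E.
Qed.

Lemma wp_while (I : nat -> seq tree -> Prop) e c l i (Q : seq tree -> Prop) :
  I i l -> (i <= b)%N ->
  (forall i l, I i l -> (evars e <= size l)%N) ->
  (forall i l, I i l -> truthy (eval e (st l)) ->
    wp c l (fun l' => exists2 j, (j < i)%N & I j l')) ->
  (forall i l, I i l -> ~~ truthy (eval e (st l)) -> Q l) ->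
  wp (While e c) l Q.
Proof.
move=> Il ib el step fin lb s ls.
pose J i s := exists l, [/\ agree l s, bounded l & I i l].
have [|||s' [j [h [l' [a' b' I']] ne]]] := @timely_while J e c s i _ _ ib.
- by move=> j u [l' [a' b' I']]; have [] := eval_agree a' b' (el _ _ I').
- move=> j u [l' [a' b' I']]; have [-> _] := eval_agree a' b' (el _ _ I').
  move=> te; have [s2 [l2 [h2 a2 b2 [k kj I2]]]] := step _ _ I' te b' u a'.
  by exists s2, k; split=> //; exists l2.
- by exists l.
- exists s', l'; split=> //; apply: (fin j) => //.
  by have [<-] := eval_agree a' b' (el _ _ I').
Qed.

(** A program expects its other variables to be 0 at the start, and calls occur inside loops, so
    what the previous call left behind must be cleared. *)
Fixpoint reset (K m : nat) : com :=
  if m is m'.+1 then Defs.Seq (reset K m') (Assign (K + m') (Cst 0)) else Skip.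

(** Variable K is variable 0 of [a], for its input and for its output; the successor covers it even
    if [a] mentions no variable. *)
Definition call (K : nat) (a : com) (x : nat) (e : expr) : com :=
  Defs.Seq (reset K (cvars a).+1)
    (Defs.Seq (Assign K e) (Defs.Seq (shift_com K a) (Assign x (Var K)))).

Lemma timely_reset K m s : exists s', [/\ timely (reset K m) s s',
  forall x, (x < m)%N -> s' (K + x)%N = Int 0 &
  forall y, (y < K)%N -> s' y = s y].
Proof.
elim: m => [|m [s' [h r f]]] /=; first by exists s; split=> //; apply: timely_skip.
exists (upd s' (K + m)%N (Int 0)); split.
- apply: timely_seq h _; apply: (@timely_assign _ (Cst 0)).
  by rewrite /= mul1n expn_gt0 b0.
- move=> x; rewrite ltnS leq_eqVlt /upd eqn_add2l => /orP[-> //|xm].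
  by rewrite ltn_eqF // r.
- by move=> y yK; rewrite /upd ltn_eqF ?f //; lia.
Qed.

Lemma wp_call K a x e l (Q : seq tree -> Prop) v t :
  [&& size l == K, opfree e, x < K & evars e <= K]%N ->
  runs no_reals a (eval e (st l)) v t -> (t <= b)%N -> (cbits a <= b)%N ->
  Q (set_nth (Int 0) l x v) -> wp (call K a x e) l Q.
Proof.
move=> /and4P[/eqP lK oe xl el] [s' [ha hv]] tb cb Ql lb s ls.
have [s1 [h1 r1 f1]] := timely_reset K (cvars a).+1 s.
have a1 : agree l s1 by move=> y yl; rewrite f1 -?lK // ls.
have [|E ce] := eval_agree a1 lb (_ : evars e <= size l)%N; first by rewrite lK.
pose s2 := upd s1 K (eval e s1).
have h2 : timely (Assign K e) s1 s2 by apply: timely_assign.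
have [|y ym|s3 [t3 [h3 l3 r3 f3]]] := @exec_shift O K (cvars a).+1 _ _ _ _ ha _ s2.
- exact: leqnSn.
- rewrite /s2 /upd -[X in _ == X]addn0 eqn_add2l E; case: eqP => // _.
  by rewrite r1.
have vb : (tbits v <= b)%N.
  rewrite -hv; apply: (tbits_exec ha) => // y; rewrite /upd; case: eqP => // _.
  exact: tbits_opfree.
(* The time of the subroutine is at most b by assumption, and a positive weight is enough to
   accommodate b. *)
have h3' : timely (shift_com K a) s2 s3.
  exists t3 => //; apply: leq_trans l3 (leq_trans tb _).
  have w0 := weight_gt0 (shift_com K a).
  by rewrite -[X in (X <= _)%N]mul1n -[X in (1 * X)%N]expn1; apply: leq_mono.
have E3 : s3 K = v by rewrite -[K]addn0 r3.
exists (upd s3 x v), (set_nth (Int 0) l x v); split=> //.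
- apply: timely_seq h1 _; apply: timely_seq h2 _; apply: timely_seq h3' _.
  rewrite -E3; apply: (@timely_assign _ (Var K)).
  by rewrite /= exp1n mul1n expn_gt0 b0.
- apply: agree_upd; last by rewrite lK.
  move=> y; rewrite lK => yK.
  by rewrite f3 // /s2 /upd ltn_eqF // f1 // ls ?lK.
- exact: bounded_upd.
Qed.

End Wp.

Arguments st l x /.

Lemma wp_runs b O c v l (Q : tree -> Prop) : (0 < b)%N -> (tbits v <= b)%N ->
  wp b O c (v :: nseq l (Int 0)) (fun l' => exists w l'', l' = w :: l'' /\ Q w) ->
  exists w t, [/\ runs O c v w t, (t <= weight c * b ^ weight c)%N,
    (tbits w <= b)%N & Q w].
Proof.
move=> b0 vb h; have [||s [l' [[t ht tb] a' b' [w [l'' [El Qw]]]]]] :=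
  h _ (upd (fun=> Int 0) 0 v).
- by rewrite /bounded /= vb; apply/(all_nthP (Int 0)) => i _; rewrite nth_nseq if_same.
- by case=> [|x] //= _; rewrite /st /= nth_nseq if_same.
- exists w, t; split=> //; last by move: b'; rewrite El => /andP[].
  by exists s; split => //; rewrite a' El.
Qed.

(** * Relaxation steps *)

Definition dot (g : nat -> int) (q : seq int) : int := \sum_(i < size q) q`_i * g i.

Definition relax (sg : int) (g : nat -> int) (q : seq int) : seq int :=
  mkseq (fun i => Num.max (q`_i + sg * g i) 0) (size q).

Lemma size_relax sg g q : size (relax sg g q) = size q.
Proof. exact: size_mkseq. Qed.

Lemma nth_relax sg g q i : (i < size q)%N ->
  (relax sg g q)`_i = Num.max (q`_i + sg * g i) 0.
Proof. by move=> iq; rewrite nth_mkseq. Qed.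

Definition dist2 (R : realDomainType) (D : nat) (p : nat -> R) (q : seq int) : R :=
  \sum_(i < size q) ((q`_i)%:~R - D%:R * p i) ^+ 2.

(* Clipping at 0 only brings the point closer to D p, and since the error of the
   violated constraint exceeds twice its tolerance, the linear term beats the
   quadratic one. *)
Lemma dist2_relax (R : realDomainType) (P D : nat) (p : nat -> R) (g : nat -> int)
    (y sg : int) (q : seq int) :
  D = (size q * P ^ 2)%N -> (forall i, 0 <= p i) ->
  (forall i, (i < size q)%N -> 0 <= g i <= P%:Z) ->
  `|\sum_(i < size q) p i * (g i)%:~R - y%:~R| <= 1 ->
  sg = 1 \/ sg = -1 -> sg * (dot g q - D%:Z * y) < - (2 * D)%:Z ->
  dist2 D p (relax sg g q) < dist2 D p q - D%:R.
Proof.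
move=> DE p0 gP hy hsg viol.
have sg2 : sg%:~R ^+ 2 = 1 :> R by case: hsg => ->; rewrite ?mulrN1z ?sqrrN expr1n.
rewrite {1}/dist2 size_relax.
pose S := \sum_(i < size q) p i * (g i)%:~R.
have le1 : \sum_(i < size q) (((relax sg g q)`_i)%:~R - D%:R * p i) ^+ 2 <=
    \sum_(i < size q) ((q`_i)%:~R - D%:R * p i + sg%:~R * (g i)%:~R) ^+ 2.
  apply: ler_sum => i _; rewrite nth_relax //.
  have -> : (q`_i)%:~R - D%:R * p i + sg%:~R * (g i)%:~R =
    (q`_i + sg * g i)%:~R - D%:R * p i by rewrite rmorphD rmorphM /=; ring.
  set x := q`_i + _; have Dp : 0 <= D%:R * p i by rewrite mulr_ge0 ?ler0n.
  case: (lerP 0 x) => x0; first by [].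
  have : x%:~R <= 0 :> R by rewrite lerz0 ltW.
  by move: (x%:~R) => u u0; rewrite !expr2; nra.
apply: le_lt_trans le1 _.
have -> : \sum_(i < size q) ((q`_i)%:~R - D%:R * p i + sg%:~R * (g i)%:~R) ^+ 2 =
  dist2 D p q +
  2 * sg%:~R * ((dot g q)%:~R - D%:R * S) + \sum_(i < size q) (g i)%:~R ^+ 2.
  rewrite /dist2 /dot rmorph_sum /= /S !mulr_sumr -sumrB mulr_sumr -!big_split /=.
  apply: eq_bigr => i _; rewrite rmorphM /=.
  set x := (q`_i)%:~R; set u := p i; set v := (g i)%:~R; set w := sg%:~R.
  have -> : v ^+ 2 = w ^+ 2 * v ^+ 2 by rewrite sg2 mul1r.
  by ring.
(* The choice D = s P^2 enters here: each of the s squares is at most P^2. *)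
have gle : \sum_(i < size q) (g i)%:~R ^+ 2 <= D%:R :> R.
  rewrite DE natrM mulr_natl -[X in _ *+ X]card_ord -sumr_const.
  apply: ler_sum => i _; have /andP[g0 g1] := gP i (ltn_ord i).
  by rewrite natrX ler_sqr ?nnegrE ?ler0z ?ler0n // (ler_int R _ P%:Z).
have viol' : sg%:~R * ((dot g q)%:~R - D%:R * y%:~R) < - (2 * D%:R) :> R.
  move: viol; rewrite -(ltr_int R) rmorphM rmorphB rmorphM rmorphN /= -!pmulrn natrM.
  by [].
have D0 : 0 <= D%:R :> R by rewrite ler0n.
(* The constraint is missed by p by at most 1, hence by D p by at most D; of the violation 2 D more
   than D remains, and it counts twice in the square. *)
have hS : sg%:~R * (D%:R * (y%:~R - S)) <= D%:R :> R.
  apply: le_trans (ler_norm _) _; rewrite normrM.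
  have -> : `|sg%:~R| = 1 :> R by case: hsg => ->; rewrite ?mulrN1z ?normrN normr1.
  by rewrite mul1r normrM (ger0_norm D0) distrC ler_piMr.
move: gle viol' hS; set A := \sum_(i < size q) (g i)%:~R ^+ 2.
move: (dot g q)%:~R (y%:~R) (sg%:~R) (D%:R : R) (dist2 D p q) => d y' w D' B h1 h2 h3.
have -> : 2 * w * (d - D' * S) = 2 * (w * (d - D' * y')) + 2 * (w * (D' * (y' - S))) by ring.
  by move: (w * (d - D' * y')) (w * (D' * (y' - S))) h2 h3 => u v; lra.
Qed.

(** Each p_i is at most 1, so D^2 times the sum of the p_i^2 is at most D^2. This start pays for
    fewer than D steps that each cost more than D. *)
Lemma dist2_zero (R : realDomainType) (D : nat) (p : nat -> R) s :
  (forall i, 0 <= p i) -> \sum_(i < s) p i = 1 ->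
  dist2 D p (nseq s 0) <= D%:R * D%:R.
Proof.
move=> p0 p1; rewrite /dist2 size_nseq.
have D0 : 0 <= D%:R :> R by rewrite ler0n.
have ple i : (i < s)%N -> p i <= 1.
  move=> si; rewrite -p1 (bigD1 (Ordinal si)) //= lerDl.
  by apply: sumr_ge0.
apply: (@le_trans _ _ (\sum_(i < s) D%:R * D%:R * p i)).
  apply: ler_sum => i _; rewrite nth_nseq ltn_ord mulr0z sub0r sqrrN expr2.
  rewrite mulrACA ler_wpM2l ?mulr_ge0 //.
  by rewrite ler_piMr // ple.
by rewrite -mulr_sumr p1 mulr1.
Qed.

(** * The programs *)

Section Programs.

Local Coercion Var : nat >-> expr.
Local Notation "x ::= e" := (Assign x e) (at level 85).
Local Notation "c ;; d" := (Defs.Seq c d) (at level 90, right associativity).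

(* Xcnt: steps left for the current s; Xz: s zeros; Xq: the weights x; Xr: rows still
   to be checked; XG: the pairs (x_l, g_l) in reverse order. *)
Local Notation Xio := 0%N.
Local Notation Xn := 1%N.
Local Notation Xrows := 2%N.
Local Notation Xk := 3%N.
Local Notation XP := 4%N.
Local Notation XD := 5%N.
Local Notation Xcnt := 6%N.
Local Notation Xz := 7%N.
Local Notation Xq := 8%N.
Local Notation Xr := 9%N.
Local Notation Xi := 10%N.
Local Notation Xy := 11%N.
Local Notation Xacc := 12%N.
Local Notation XG := 13%N.
Local Notation Xt := 14%N.
Local Notation Xl := 15%N.
Local Notation Xg := 16%N.

(* The first row is the integer 1 and stands for the normalization constraint. *)
Definition first_row : expr := Op OAdd (Hd Xr) (Cst 0).

(** The addition of 0 in [first_row] forces a reading as an integer: an encoded bit string gives 0,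
    be it empty ([Int 0]) or a pair, so only the normalization row passes the test. *)
Definition dot_body (a : com) : com :=
  If first_row (Xg ::= XP)
    (call 17 a Xg (Defs.Cons Xn (Defs.Cons Xl (Defs.Cons (Hd Xr) (Cst 0)))) ;;
     Xg ::= Op ODiv (Op OMul XP (Hd Xg)) (Tl Xg)) ;;
  Xacc ::= Op OAdd Xacc (Op OMul (Hd Xt) Xg) ;;
  XG ::= Defs.Cons (Defs.Cons (Hd Xt) Xg) XG ;;
  Xt ::= Tl Xt ;;
  Xl ::= Op OAdd Xl (Cst 1).

Definition dot_loop (a : com) : com := While (IsPair Xt) (dot_body a).

(** Multiplication by the truth value of 0 <= t is the clipping max(t, 0). As [XG] is reversed,
    consing its entries onto [Xq] restores the order of the states. *)
Definition relax_body : com :=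
  Xt ::= Op OAdd (Hd (Hd XG)) (Op OMul Xg (Tl (Hd XG))) ;;
  Xq ::= Defs.Cons (Op OMul Xt (Op OLeq (Cst 0) Xt)) Xq ;;
  XG ::= Tl XG.

Definition relax_loop : com := While (IsPair XG) relax_body.

(** Over the integers |e| > 2 D means |e| >= 2 D + 1, which [OLeq] can test. *)
Definition twoD1 : expr := Op OAdd (Op OAdd XD XD) (Cst 1).

(** A step may spoil constraints that were already checked, so checking restarts at the first row.
    An exhausted counter raises s by one: D grows by P^2 and the weights return to zero. *)
Definition violated : com :=
  Xcnt ::= Op OSub Xcnt (Cst 1) ;;
  Xr ::= Xrows ;;
  Xi ::= Cst 0 ;;
  If Xcnt
    (Xq ::= Cst 0 ;; relax_loop)
    (Xz ::= Defs.Cons (Cst 0) Xz ;;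
     Xq ::= Xz ;;
     XD ::= Op OAdd XD (Op OMul XP XP) ;;
     Xcnt ::= XD).

(** Row i reads real input i: input 0 is 1/eta, and row 0, the normalization, reads no datum, so the
    two numberings agree without a shift. *)
Definition main_body (a : com) : com :=
  If first_row (Xy ::= XP) (Get Xy Xi Xk) ;;
  Xacc ::= Cst 0 ;;
  XG ::= Cst 0 ;;
  Xt ::= Xq ;;
  Xl ::= Cst 0 ;;
  dot_loop a ;;
  Xacc ::= Op OSub Xacc (Op OMul XD Xy) ;;
  Xg ::= Op OSub (Op OLeq (Op OAdd Xacc twoD1) (Cst 0)) (Op OLeq twoD1 Xacc) ;;
  If Xg violated (Xr ::= Tl Xr ;; Xi ::= Op OAdd Xi (Cst 1)).

Definition main_loop (a : com) : com := While (IsPair Xr) (main_body a).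

Definition sum_loop : com :=
  While (IsPair Xq)
    (Xacc ::= Op OAdd Xacc (Hd Xq) ;;
     XG ::= Defs.Cons (Hd Xq) XG ;;
     Xq ::= Tl Xq).

Definition output_loop : com :=
  While (IsPair XG)
    (Xio ::= Defs.Cons (Defs.Cons (Hd XG) Xacc) Xio ;;
     XG ::= Tl XG).

(** With Z = floor(1/eta) in [Xt], doubling stops at the first power of two P >= 8 (Z + 1) > 8 /
    eta; starting from 8 gives P <= 16 (Z + 1). *)
Definition precision_loop : com :=
  While (Op OLeq XP (Op OAdd (Op OMul (Cst 8) Xt) (Cst 7)))
    (XP ::= Op OAdd XP XP ;;
     Xk ::= Op OAdd Xk (Cst 1)).

Definition search (a : com) : com :=
  Xz ::= Defs.Cons (Cst 0) (Cst 0) ;;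
  Xq ::= Xz ;;
  XD ::= Op OMul XP XP ;;
  Xcnt ::= XD ;;
  Xr ::= Xrows ;;
  Xi ::= Cst 0 ;;
  main_loop a ;;
  Xacc ::= Cst 0 ;;
  XG ::= Cst 0 ;;
  sum_loop ;;
  Xio ::= Cst 0 ;;
  output_loop.

Definition learner (a : com) : com :=
  Xn ::= Hd Xio ;;
  Xrows ::= Defs.Cons (Cst 1) (Hd (Tl Xio)) ;;
  XP ::= Cst 8 ;;
  Xk ::= Cst 3 ;;
  Get Xt (Cst 0) (Cst 0) ;;
  precision_loop ;;
  search a.

(* 2: rest of w; 3: E; 4: index l; 5, 6: numerator and denominator of the partial
   sum; 7: f(l,E). *)
Definition predict_body (a : com) : com :=
  call 8 a 7 (Defs.Cons 1%N (Defs.Cons 4%N (Defs.Cons 3%N (Cst 0)))) ;;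
  5%N ::= Op OAdd (Op OMul 5%N (Op OMul (Tl (Hd 2%N)) (Tl 7%N)))
            (Op OMul 6%N (Op OMul (Hd (Hd 2%N)) (Hd 7%N))) ;;
  6%N ::= Op OMul 6%N (Op OMul (Tl (Hd 2%N)) (Tl 7%N)) ;;
  2%N ::= Tl 2%N ;;
  4%N ::= Op OAdd 4%N (Cst 1).

Definition predict_loop (a : com) : com := While (IsPair 2%N) (predict_body a).

Definition predictor (a : com) : com :=
  1%N ::= Hd 0%N ;;
  2%N ::= Hd (Tl 0%N) ;;
  3%N ::= Hd (Tl (Tl 0%N)) ;;
  4%N ::= Cst 0 ;;
  5%N ::= Cst 0 ;;
  6%N ::= Cst 1 ;;
  predict_loop a ;;
  0%N ::= Defs.Cons 5%N 6%N.

End Programs.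

(** * The learner *)

(** Only [rtree] is stored by the program; the rounded integers of the other two fields are computed
    or read anew at each check. *)
Record row := Row { rtree : tree; rval : int; rcoef : nat -> int }.

Definition enc_ints (q : seq int) : tree := enc_seq [seq Int x | x <- q].

Definition zipg (g : nat -> int) (q : seq int) : seq tree :=
  mkseq (fun i => Pair (Int q`_i) (Int (g i))) (size q).

Lemma is_pair_enc l : is_pair (enc_seq l) = (0 < size l)%N.
Proof. by case: l. Qed.

Lemma posz_bool (c : bool) : (Posz c != 0) = c. Proof. by case: c. Qed.

Lemma enc_ints_drop (q : seq int) j : (j < size q)%N ->
  enc_seq (drop j [seq Int x | x <- q]) =
  Pair (Int q`_j) (enc_seq (drop j.+1 [seq Int x | x <- q])).
Proof.
by move=> jq; rewrite (drop_nth (Int 0)) ?size_map // (nth_map 0).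
Qed.

Lemma enc_rev_take (l : seq tree) j : (j < size l)%N ->
  enc_seq (rev (take j.+1 l)) = Pair (nth (Int 0) l j) (enc_seq (rev (take j l))).
Proof. by move=> jl; rewrite (take_nth (Int 0)) // rev_rcons. Qed.

Lemma abs_sum_leq (F : nat -> int) m c :
  (forall i, (i < m)%N -> (`|F i| <= c)%N) -> (`|(\sum_(i < m) F i)%R| <= m * c)%N.
Proof.
elim: m => [|m IH] h; first by rewrite big_ord0.
rewrite big_ord_recr /= mulSn; have := IH (fun i im => h i (ltnW im)); have := h m (ltnSn m).
by move: (F m) (\sum_(i < m) F i); lia.
Qed.

Section Learner.
Variables (b : nat) (O : nat -> nat -> int) (a : com) (nn k s0 : nat) (P : nat).
Hypothesis b0 : (0 < b)%N.
Hypothesis ab : (cbits a <= b)%N.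

(** Bounds for D and for a single weight, uniform in the guesses s <= s0: a weight grows by at most
    P per step, and at most D steps are made. *)
Variables Dm Xm : nat.
Hypothesis DmE : Dm = (s0 * P ^ 2)%N.
Hypothesis XmE : Xm = (Dm * P)%N.
Hypothesis Vb : (s0 * (Xm * P) + Dm * P + Xm + Dm * 2 + P + k + s0 + 8 < b)%N.

Let Vb' : (Xm + Dm * 2 + P + k + s0 + 8 < b)%N.
Proof.
by apply: leq_ltn_trans Vb; move: (_ * (_ * _))%N (Dm * P)%N => u v; lia.
Qed.

Definition row_ok (i : nat) (r : row) :=
  [/\ forall l, (l < s0)%N -> 0 <= rcoef r l <= P%:Z, 0 <= rval r <= P%:Z &
    [/\ rtree r = Int 1, rval r = P%:Z & forall l, rcoef r l = P%:Z] \/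
    [/\ int_of (rtree r) = 0, O i k = rval r & forall l, (l < s0)%N ->
      exists num den t, [/\ runs no_reals a
         (enc_seq [:: enc_nat nn; enc_nat l; rtree r]) (Pair (Int num) (Int den)) t,
        (t <= b)%N & (P%:Z * num %/ den)%Z = rcoef r l]]].

Lemma wp_dot_loop io rows D cnt z q' r rs i y (q : seq int) gv (Q : seq tree -> Prop) :
  row_ok i r -> (size q <= s0)%N -> (forall j, 0 <= q`_j <= Xm%:Z) ->
  (forall gv', Q [:: io; enc_nat nn; rows; Int k; Int P; D; cnt; z; q';
     Pair (rtree r) rs; Int i; y; Int (dot (rcoef r) q);
     enc_seq (rev (zipg (rcoef r) q)); Int 0; Int (size q); gv']) ->
  wp b O (dot_loop a) [:: io; enc_nat nn; rows; Int k; Int P; D; cnt; z; q';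
     Pair (rtree r) rs; Int i; y; Int 0; Int 0; enc_ints q; Int 0; gv] Q.
Proof.
move=> [gP yP rok] qs qX hQ.
pose g := rcoef r.
pose I c l := exists j gv', [/\ (j + c)%N = size q &
  l = [:: io; enc_nat nn; rows; Int k; Int P; D; cnt; z; q';
     Pair (rtree r) rs; Int i; y; Int (\sum_(i < j) q`_i * g i);
     enc_seq (rev (take j (zipg g q))); enc_seq (drop j [seq Int x | x <- q]);
     Int j; gv']].
apply: (@wp_while _ _ b0 I _ _ _ (size q)).
- by exists 0%N, gv; rewrite add0n big_ord0 take0 drop0.
- by lia.
- by move=> c l [j [gv' [_ ->]]].
- move=> c l [j [gv' [jc ->]]] /=; rewrite posz_bool is_pair_enc size_drop size_map => jq.
  have {}jq : (j < size q)%N by lia.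
  have /andP[g0 gp] : 0 <= g j <= P%:Z by apply: gP; lia.
  pose Q1 l' := l' = [:: io; enc_nat nn; rows; Int k; Int P; D; cnt; z; q';
     Pair (rtree r) rs; Int i; y; Int (\sum_(i < j) q`_i * g i);
     enc_seq (rev (take j (zipg g q))); enc_seq (drop j [seq Int x | x <- q]);
     Int j; Int (g j)].
  apply: wp_seq => //; apply: (@wp_weaken _ _ _ _ Q1).
  + move=> _ ->; rewrite enc_ints_drop //.
    apply: wp_seq => //; apply: wp_assign => //=.
      move=> _; apply: bitlen_leq_abs.
      have : (`|(\sum_(i < j.+1) q`_i * g i)%R| <= j.+1 * (Xm * P))%N.
        apply: (@abs_sum_leq (fun i => q`_i * g i)) => i' ij.
        have := qX i'; have /andP[] : 0 <= g i' <= P%:Z by apply: gP; lia.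
        by rewrite abszM => h1 h2 /andP[h3 h4]; apply: leq_mul; lia.
      rewrite big_ord_recr /=; have : (j.+1 * (Xm * P) <= s0 * (Xm * P))%N.
        by rewrite leq_mul2r; lia.
      by move=> h1 h2; apply: leq_ltn_trans (leq_trans h2 h1) _; lia.
    apply: wp_seq => //; apply: wp_move => //=.
    apply: wp_seq => //; apply: wp_move => //=.
    apply: wp_assign => //=; first by move=> _; apply: bitlen_leq_abs; lia.
    exists c.-1; first by lia.
    exists j.+1, (Int (g j)); split; first by lia.
    rewrite big_ord_recr /= enc_rev_take ?size_mkseq // nth_mkseq //.
    by rewrite -PoszD addn1.
  + apply: wp_if => //=.
      case: rok => [[Er Ey Eg]|[-> //]] _.
      by apply: wp_move => //=; rewrite /Q1 -(Eg j).
    case: rok => [[-> //]|[_ _ hr] _].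
    have [|num [den [t [ht tb hg]]]] := hr j; first by lia.
    apply: wp_seq => //; apply: (@wp_call _ _ b0 _ _ _ _ _ _ (Pair (Int num) (Int den)) t) => //=.
    apply: wp_assign => //=; last by rewrite /Q1 hg.
    by move=> _; rewrite hg; apply: bitlen_leq_abs; rewrite -/g; lia.
- move=> c l [j [gv' [jc ->]]] /=; rewrite posz_bool is_pair_enc size_drop size_map => jq.
  have -> : j = size q by lia.
  by rewrite drop_oversize ?size_map // take_oversize ?size_mkseq.
Qed.

Lemma wp_relax_loop io n rows kv Pv D cnt z r i y acc (q : seq int) (g : nat -> int) (sg : int) t lv
    (Q : seq tree -> Prop) :
  (forall l, (l < size q)%N -> 0 <= g l <= P%:Z) -> (size q <= s0)%N ->
  (forall j, 0 <= q`_j <= Xm%:Z) -> sg = 1 \/ sg = -1 ->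
  (forall t', Q [:: io; n; rows; kv; Pv; D; cnt; z; enc_ints (relax sg g q); r; i; y;
     acc; Int 0; t'; lv; Int sg]) ->
  wp b O relax_loop [:: io; n; rows; kv; Pv; D; cnt; z; Int 0; r; i; y; acc;
     enc_seq (rev (zipg g q)); t; lv; Int sg] Q.
Proof.
move=> gP qs qX hsg hQ.
(* There are c entries of [XG] left; states are processed from the last to the first, so [Xq] holds
   the part from c on. *)
pose I c l := (c <= size q)%N /\ exists t',
  l = [:: io; n; rows; kv; Pv; D; cnt; z;
     enc_seq (drop c [seq Int x | x <- relax sg g q]); r; i; y;
     acc; enc_seq (rev (take c (zipg g q))); t'; lv; Int sg].
have sr := size_relax sg g q.
apply: (@wp_while _ _ b0 I _ _ _ (size q)).
- split=> //; exists t; rewrite take_oversize ?size_mkseq // drop_oversize //.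
  by rewrite size_map sr.
- by lia.
- by move=> c l [_ [t' ->]].
- move=> [|c] l [cq [t' ->]] /=; first by rewrite take0.
  move=> _; rewrite enc_rev_take ?size_mkseq // nth_mkseq //.
  have xb : (`|(q`_c + sg * g c)%R| < b)%N.
    by move: (gP c cq) (qX c) hsg; move: q`_c (g c) => u v ? ? [] ->; lia.
  apply: wp_seq => //; apply: wp_assign => //=.
    by move=> _; apply: bitlen_leq_abs.
  apply: wp_seq => //; apply: wp_assign => //=.
    move=> bl; rewrite geq_max; apply/andP; split.
      by apply: bitlen_leq_abs; move: (_ + _) xb => x; case: (lerP 0 x) => /=; lia.
    by move: bl => /and5P[_ _ _ _ /and5P[_ _ _ _ /andP[]]].
  apply: wp_move => //=.
  exists c => //; split; first exact: ltnW.
  exists (Int (q`_c + sg * g c)); do ![congr cons].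
  rewrite (@enc_ints_drop (relax sg g q) c) ?sr //; congr (Pair (Int _) _).
  apply: etrans (esym (nth_relax _ _ cq)).
  by case: (lerP 0 (q`_c + sg * g c)) => /= _; rewrite ?mulr1 ?mulr0.
- move=> c l [cq [t' ->]] /=; rewrite posz_bool is_pair_enc size_rev size_take size_mkseq.
  move=> h; have -> : c = 0%N by move: h; case: ifP; lia.
  by rewrite take0 drop0.
Qed.

Definition enc_rows (l : seq row) : tree := enc_seq [seq rtree r | r <- l].

Variables (R : realDomainType) (p : nat -> R) (rows : seq row).
Hypotheses (p0 : forall i, 0 <= p i) (p1 : \sum_(i < s0) p i = 1).
Hypotheses (s0_gt0 : (0 < s0)%N) (P_gt0 : (0 < P)%N).
Let dflt := Row (Int 0) 0 (fun=> 0).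
Let rowi i := nth dflt rows i.
Hypothesis rows_ok : forall i, (i < size rows)%N -> row_ok i (rowi i).
Hypothesis rows_p : forall i, (i < size rows)%N ->
  `|\sum_(j < s0) p j * (rcoef (rowi i) j)%:~R - (rval (rowi i))%:~R| <= 1.
Hypothesis rows_b : (size rows < b)%N.

Definition satisfied (D : nat) (q : seq int) (r : row) :=
  (`|(dot (rcoef r) q - D%:Z * rval r)%R| <= 2 * D)%N.

Record config := Config { cs : nat; ccnt : nat; ci : nat; cq : seq int }.

Let cD c := (cs c * P ^ 2)%N.

(** D - cnt steps have been made, each raising a weight by at most P. The potential is bounded only
    when the guess equals s0, since for a smaller one the mass of p need not lie on the first s
    states. *)
Definition config_ok (c : config) :=
  [/\ (0 < cs c <= s0)%N, size (cq c) = cs c, (0 < ccnt c <= cD c)%N,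
    forall j, 0 <= (cq c)`_j <= ((cD c - ccnt c) * P)%:Z &
    [/\ (ci c <= size rows)%N,
      forall i, (i < ci c)%N -> satisfied (cD c) (cq c) (rowi i) &
      cs c = s0 -> dist2 (cD c) p (cq c) <= (cD c)%:R * (ccnt c)%:R]].

(** The lexicographic order on (guesses left, steps left, rows left) packed into one number: it is
    the variant of the main loop, and its initial value bounds the number of rounds. *)
Definition rank (c : config) : nat :=
  (((s0 - cs c) * Dm.+1 + ccnt c) * (size rows).+2 + (size rows - ci c))%N.

Definition config_env (io : tree) (c : config) (y acc G t l g : tree) : seq tree :=
  [:: io; enc_nat nn; enc_rows rows; Int k; Int P; Int (cD c); Int (ccnt c);
     enc_ints (nseq (cs c) 0); enc_ints (cq c); enc_rows (drop (ci c) rows);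
     Int (ci c); y; acc; G; t; l; g].

Lemma ltn_lex u v m x y : (u < v)%N -> (x <= m)%N ->
  (u * m.+2 + x < v * m.+2 + y)%N.
Proof.
move=> uv xm; apply: (@leq_trans (u.+1 * m.+2)); first by rewrite mulSn; lia.
by apply: leq_trans (leq_addr _ _); rewrite leq_mul2r uv orbT.
Qed.

Lemma wp_main_body io c y acc G t l g (Q : seq tree -> Prop) :
  config_ok c -> (ci c < size rows)%N ->
  (forall c' y acc G t l g, config_ok c' -> (rank c' < rank c)%N ->
     Q (config_env io c' y acc G t l g)) ->
  wp b O (main_body a) (config_env io c y acc G t l g) Q.
Proof.
move=> [/andP[s_gt0 s_le] sq /andP[cnt_gt0 cnt_le] qP [i_le sat pot]] im hQ.
case: c => s cnt i q /= in s_gt0 s_le sq cnt_gt0 cnt_le qP i_le sat pot im hQ *.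
rewrite /cD /= in cnt_le qP sat pot.
set D := (s * P ^ 2)%N in cnt_le qP sat pot.
have D_le : (D <= Dm)%N by rewrite DmE leq_mul2r s_le orbT.
have qX j : 0 <= q`_j <= Xm%:Z.
  have /andP[-> /=] := qP j; move/le_trans; apply; rewrite lez_nat XmE.
  by rewrite leq_mul2r; apply/orP; right; lia.
pose r := rowi i.
have [gP /andP[y0 yP] rok] := rows_ok im; rewrite -/r in gP y0 yP rok.
have hdrop : enc_rows (drop i rows) = Pair (rtree r) (enc_rows (drop i.+1 rows)).
  by rewrite /enc_rows (drop_nth dflt).
rewrite /config_env /= hdrop -/D.
pose Q1 l' := l' = [:: io; enc_nat nn; enc_rows rows; Int k; Int P; Int D; Int cnt;
     enc_ints (nseq s 0); enc_ints q; Pair (rtree r) (enc_rows (drop i.+1 rows));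
     Int i; Int (rval r); acc; G; t; l; g].
apply: wp_seq => //; apply: (@wp_weaken _ _ _ _ Q1); last first.
  apply: wp_if => //=.
    by case: rok => [[Er Ey _]|[-> //]] _; apply: wp_move => //=; rewrite /Q1 Ey.
  case: rok => [[-> //]|[_ EO _] _].
  by apply: wp_get => //=; rewrite ?EO //; first lia; first lia; apply: bitlen_leq_abs; lia.
move=> _ ->.
apply: wp_seq => //; apply: wp_move => //=.
apply: wp_seq => //; apply: wp_move => //=.
apply: wp_seq => //; apply: wp_move => //=.
apply: wp_seq => //; apply: wp_move => //=.
apply: wp_seq => //; apply: wp_dot_loop => //; rewrite ?sq //.
  by split=> //; rewrite y0.
move=> gv.
have dot_le : (`|dot (rcoef r) q| <= s0 * (Xm * P))%N.
  apply: (@leq_trans (s * (Xm * P))); last by rewrite leq_mul2r s_le orbT.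
  rewrite /dot -sq; apply: (@abs_sum_leq (fun i => q`_i * rcoef r i)) => j js.
  have /gP : (j < s0)%N by lia.
  by move: (qX j); rewrite abszM; move: q`_j (rcoef r j) => u v ? ?; apply: leq_mul; lia.
have Dy_le : (`|(D%:Z * rval r)%R| <= Dm * P)%N by rewrite abszM leq_mul; lia.
set e : int := dot (rcoef r) q - D%:Z * rval r.
have e_le : (`|e| <= s0 * (Xm * P) + Dm * P)%N by lia.
apply: wp_seq => //; apply: wp_assign => //=.
  move=> _; apply: bitlen_leq_abs; apply: leq_ltn_trans e_le _.
  by apply: leq_ltn_trans Vb; rewrite -!addnA !leq_add // leq_addr.
(* The direction of the correction: 1 if the sum falls short, -1 if it is too large, 0 if the
   constraint holds. *)
pose sg : int := Posz (e + (D%:Z + D%:Z + 1) <= 0)%R - Posz (D%:Z + D%:Z + 1 <= e)%R.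
apply: wp_seq => //; apply: wp_assign => //=.
  by move=> _; apply: bitlen_leq_abs; case: (_ <= 0); case: (_ <= e) => //=; lia.
rewrite -/e -/sg; apply: wp_if => //= hsg.
- have {}hsg : (sg = 1 \/ sg = -1) /\ sg * e < - (2 * D)%:Z.
    move: hsg; rewrite /sg.
    case: (lerP (e + _) 0) => h1; case: (lerP _ e) => h2 /=; lia.
  case: hsg => hsg viol.
  have step : s = s0 ->
      dist2 D p (relax sg (rcoef r) q) < D%:R * cnt%:R - D%:R.
    move=> ss; have := @dist2_relax R P D p (rcoef r) (rval r) sg q.
    move=> /(_ _ p0 _ _ hsg viol) h; apply: lt_le_trans (h _ _ _) _.
    + by rewrite sq.
    + by move=> j; rewrite sq ss; apply: gP.
    + by rewrite sq ss; apply: rows_p.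
    + by rewrite lerB // pot.
  apply: wp_seq => //; apply: wp_assign => //=.
    by move=> _; apply: bitlen_leq_abs; lia.
  apply: wp_seq => //; apply: wp_move => //=.
  apply: wp_seq => //; apply: wp_move => //=.
  have cntE : cnt%:Z - 1 = cnt.-1%:Z by lia.
  rewrite cntE; apply: wp_if => //= hc.
  + apply: wp_seq => //; apply: wp_move => //=.
    apply: wp_relax_loop => //; rewrite ?sq //.
      by move=> j js; apply: gP; apply: leq_trans s_le.
    move=> t'.
    have := hQ (Config s cnt.-1 0 (relax sg (rcoef r) q)).
    rewrite /config_env /= drop0; apply; last first.
      by rewrite /rank /=; apply: ltn_lex; lia.
    have cnt1 : (0 < cnt.-1)%N by lia.
    split; rewrite /= ?s_gt0 ?s_le ?size_relax //.
    * by rewrite cnt1 /cD /= -/D; lia.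
    * move=> j; rewrite /cD /= -/D; case: (ltnP j (size q)) => js; last first.
        by rewrite nth_default ?size_relax.
      rewrite nth_relax //.
      have /gP : (j < s0)%N by lia.
      have -> : ((D - cnt.-1) * P = (D - cnt) * P + P)%N.
        by rewrite -[X in (_ + X)%N]mul1n -mulnDl; congr (_ * _)%N; lia.
      move: (qP j); move: ((D - cnt) * P)%N q`_j (rcoef r j) => X u v hu.
      by case: hsg => ->; case: (lerP 0 (u + _)) => /=; lia.
    * split=> // ss; rewrite /cD /= -/D; apply: ltW; apply: lt_le_trans (step ss) _.
      by rewrite -[X in _ - X]mulr1 -mulrBr ler_wpM2l ?ler0n // -(natrB _ cnt_gt0) subn1.
  + have cnt1 : cnt = 1%N by move: hc; lia.
    (* If s were s0, the step that uses up the counter would make a sum of squares negative; hence s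
       < s0, and the next guess is still at most s0. *)
    have ss : (s < s0)%N.
      rewrite ltn_neqAle s_le andbT; apply/eqP => /step.
      rewrite cnt1 mulr1 subrr ltNge sumr_ge0 // => j _; exact: sqr_ge0.
    apply: wp_seq => //; apply: wp_move => //=.
    apply: wp_seq => //; apply: wp_move => //=.
    have D' : (s.+1 * P ^ 2 = D + P * P)%N by rewrite mulSn addnC.
    have D'_le : (D + P * P <= Dm)%N by rewrite -D' DmE leq_mul2r ss orbT.
    apply: wp_seq => //; apply: wp_assign => //=.
      by move=> _; apply: bitlen_leq_abs; lia.
    apply: wp_move => //=.
    have := hQ (Config s.+1 (s.+1 * P ^ 2) 0 (nseq s.+1 0)).
    rewrite /config_env /= drop0 /cD /= D'; apply; last first.
      rewrite /rank /= cnt1.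
      have -> : (s0 - s = (s0 - s.+1).+1)%N by lia.
      by apply: ltn_lex; rewrite ?mulSn; lia.
    split; rewrite /= ?size_nseq /cD /= ?D' //.
    * by rewrite leqnn andbT addn_gt0 [X in _ || X]muln_gt0 P_gt0 orbT.
    * by move=> j; rewrite subnn mul0n -[0 :: _]/(nseq s.+1 0) nth_nseq if_same.
    * by split=> // ss'; rewrite -D'; apply: (@dist2_zero R _ p s.+1) => //; rewrite ss'.
- have sat_i : satisfied D q r.
    move: hsg; rewrite /satisfied -/e /sg.
    by case: (lerP (e + _) 0) => h1; case: (lerP _ e) => h2 /=; lia.
  apply: wp_seq => //; apply: wp_move => //=.
  apply: wp_assign => //=; first by move=> _; apply: bitlen_leq_abs; lia.
  have := hQ (Config s cnt i.+1 q).
  rewrite /config_env /= -PoszD addn1; apply.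
    split; rewrite /= ?s_gt0 ?s_le ?cnt_gt0 //.
    split=> // j; rewrite ltnS leq_eqVlt => /orP[/eqP ->|ji] //.
    exact: sat.
  by rewrite /rank /=; lia.
Qed.

Lemma wp_main_loop io c y acc G t l g (Q : seq tree -> Prop) :
  config_ok c -> (rank c <= b)%N ->
  (forall c' y acc G t l g, config_ok c' -> ci c' = size rows ->
     Q (config_env io c' y acc G t l g)) ->
  wp b O (main_loop a) (config_env io c y acc G t l g) Q.
Proof.
move=> cok rb hQ.
pose I n L := exists c' y acc G t l g, [/\ config_ok c', rank c' = n &
  L = config_env io c' y acc G t l g].
have isp c' : is_pair (enc_rows (drop (ci c') rows)) = (ci c' < size rows)%N.
  by rewrite is_pair_enc size_map size_drop subn_gt0.
apply: (@wp_while _ _ b0 I _ _ _ (rank c)) => //.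
- by exists c, y, acc, G, t, l, g.
- by move=> n L [c' [y' [acc' [G' [t' [l' [g' [_ _ ->]]]]]]]].
- move=> n L [c' [y' [acc' [G' [t' [l' [g' [ok' <- ->]]]]]]]] /=.
  rewrite posz_bool isp => im; apply: wp_main_body => // c2 y2 acc2 G2 t2 l2 g2 ok2 rk.
  by exists (rank c2) => //; exists c2, y2, acc2, G2, t2, l2, g2.
- move=> n L [c' [y' [acc' [G' [t' [l' [g' [ok' _ ->]]]]]]]] /=.
  rewrite posz_bool isp => im; apply: hQ => //.
  by case: ok' => _ _ _ _ [im' _ _]; lia.
Qed.

Definition enc_normalized (q : seq int) : tree :=
  enc_seq [seq enc_frac (x, \sum_(i < size q) q`_i) | x <- q].

Lemma wp_sum_loop io n rows' kv Pv D cnt z (q : seq int) r i y t l g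
    (Q : seq tree -> Prop) :
  (size q <= s0)%N -> (forall j, 0 <= q`_j <= Xm%:Z) ->
  Q [:: io; n; rows'; kv; Pv; D; cnt; z; Int 0; r; i; y; Int (\sum_(i < size q) q`_i);
     enc_seq (rev [seq Int x | x <- q]); t; l; g] ->
  wp b O sum_loop [:: io; n; rows'; kv; Pv; D; cnt; z; enc_ints q; r; i; y;
     Int 0; Int 0; t; l; g] Q.
Proof.
move=> qs qX hQ.
pose I c L := exists j, (j + c)%N = size q /\
  L = [:: io; n; rows'; kv; Pv; D; cnt; z; enc_seq (drop j [seq Int x | x <- q]);
    r; i; y; Int (\sum_(i < j) q`_i); enc_seq (rev (take j [seq Int x | x <- q])); t; l; g].
apply: (@wp_while _ _ b0 I _ _ _ (size q)).
- by exists 0%N; rewrite big_ord0 take0 drop0.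
- by lia.
- by move=> c L [j [_ ->]].
- move=> c L [j [jc ->]] /=; rewrite posz_bool is_pair_enc size_drop size_map => jq.
  have {}jq : (j < size q)%N by lia.
  rewrite enc_ints_drop //; apply: wp_seq => //; apply: wp_assign => //=.
    move=> _; apply: bitlen_leq_abs.
    have : (`|(\sum_(i < j.+1) q`_i)%R| <= j.+1 * Xm)%N.
      by apply: (@abs_sum_leq (fun i => q`_i)) => i' _; move: (qX i'); move: q`_i' => u; lia.
    have : (j.+1 * Xm <= s0 * (Xm * P))%N.
      by apply: leq_mul; [lia|rewrite leq_pmulr].
    rewrite big_ord_recr /= => h1 h2; apply: leq_ltn_trans (leq_trans h2 h1) _.
    by move: (s0 * (Xm * P))%N Vb => u; move: (Dm * P)%N => v; lia.
  apply: wp_seq => //; apply: wp_move => //=; apply: wp_move => //=.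
  exists c.-1; first by lia.
  exists j.+1; split; first by lia.
  by rewrite big_ord_recr /= enc_rev_take ?size_map // (nth_map 0).
- move=> c L [j [jc ->]] /=; rewrite posz_bool is_pair_enc size_drop size_map => jq.
  have -> : j = size q by lia.
  by rewrite drop_oversize ?size_map // take_oversize ?size_map.
Qed.

Lemma wp_output_loop n rows' kv Pv D cnt z q' (q : seq int) r i y t l g
    (Q : seq tree -> Prop) :
  (size q <= s0)%N ->
  Q [:: enc_normalized q; n; rows'; kv; Pv; D; cnt; z; q'; r; i; y;
     Int (\sum_(i < size q) q`_i); Int 0; t; l; g] ->
  wp b O output_loop [:: Int 0; n; rows'; kv; Pv; D; cnt; z; q'; r; i; y;
     Int (\sum_(i < size q) q`_i); enc_seq (rev [seq Int x | x <- q]); t; l; g] Q.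
Proof.
move=> qs hQ; set S := \sum_(i < size q) q`_i.
pose w := [seq enc_frac (x, S) | x <- q].
pose I c L := (c <= size q)%N /\
  L = [:: enc_seq (drop c w); n; rows'; kv; Pv; D; cnt; z; q'; r; i; y;
     Int S; enc_seq (rev (take c [seq Int x | x <- q])); t; l; g].
apply: (@wp_while _ _ b0 I _ _ _ (size q)).
- by split=> //; rewrite drop_oversize ?size_map // take_oversize ?size_map.
- by lia.
- by move=> c L [_ ->].
- move=> [|c] L [cq ->] /=; first by rewrite take0.
  move=> _; rewrite enc_rev_take ?size_map //.
  apply: wp_seq => //; apply: wp_move => //=; apply: wp_move => //=.
  exists c => //; split; first exact: ltnW.
  by rewrite [in RHS](drop_nth (Int 0)) ?size_map // !(nth_map 0).
- move=> c L [cq ->] /=; rewrite posz_bool is_pair_enc size_rev size_take size_map.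
  move=> h; have -> : c = 0%N by move: h; case: ifP; lia.
  by rewrite take0 drop0.
Qed.

Hypothesis rank_b : ((s0 * Dm.+1 + Dm) * (size rows).+2 + size rows <= b)%N.

Lemma wp_search io z D cnt q0 r i y acc G t l g (Q : seq tree -> Prop) :
  (forall D q L, [/\ (0 < size q <= s0)%N, D = (size q * P ^ 2)%N,
      forall j, 0 <= q`_j & forall j, (j < size rows)%N -> satisfied D q (rowi j)] ->
    Q (enc_normalized q :: L)) ->
  wp b O (search a) [:: io; enc_nat nn; enc_rows rows; Int k; Int P; D; cnt; z; q0;
     r; i; y; acc; G; t; l; g] Q.
Proof.
move=> hQ.
have PD : (P * P <= Dm)%N by rewrite DmE leq_pmull.
apply: wp_seq => //; apply: wp_move => //=.
apply: wp_seq => //; apply: wp_move => //=.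
apply: wp_seq => //; apply: wp_assign => //=.
  by move=> _; apply: bitlen_leq_abs; rewrite -PoszM; lia.
apply: wp_seq => //; apply: wp_move => //=.
apply: wp_seq => //; apply: wp_move => //=.
apply: wp_seq => //; apply: wp_move => //=.
apply: wp_seq => //.
(* The guess s = 1 is admissible because s0 > 0; if s0 = 1, the potential bound is already due
   here. *)
pose c := Config 1 (P * P) 0 [:: 0].
have := @wp_main_loop io c y acc G t l g.
rewrite /config_env /= drop0 /cD /= mul1n; apply.
- split; rewrite /= /cD /= ?mul1n //.
  + by rewrite leqnn andbT muln_gt0 P_gt0.
  + by move=> j; rewrite subnn mul0n -[[:: 0]]/(nseq 1 0) nth_nseq if_same.
  + by split=> // ss; apply: (@dist2_zero R _ p 1) => //; rewrite ss.
- apply: leq_trans rank_b; rewrite /rank /= leq_add ?leq_subr // leq_mul2r.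
  by rewrite leq_add ?orbT // leq_mul2r leq_subr orbT.
- move=> {y acc G t l g} c' y acc G t l g [/andP[c1 c2] sq /andP[c3 c4] qP [_ sat _]] cm.
  rewrite /config_env.
  have qX j : 0 <= (cq c')`_j <= Xm%:Z.
    have /andP[-> /=] := qP j; move/le_trans; apply; rewrite lez_nat XmE.
    rewrite leq_mul2r (leq_trans (leq_subr _ _)) ?orbT // /cD DmE.
    by rewrite leq_mul2r c2 orbT.
  apply: wp_seq => //; apply: wp_move => //=.
  apply: wp_seq => //; apply: wp_move => //=.
  apply: wp_seq => //; apply: wp_sum_loop => //; first by rewrite sq.
  apply: wp_seq => //; apply: wp_move => //=.
  apply: wp_output_loop => //; first by rewrite sq.
  apply: (hQ (cD c')); split; rewrite ?sq ?c1 //.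
  + by move=> j; case/andP: (qX j).
  + by move=> j jm; apply: sat; rewrite cm.
Qed.

End Learner.

Lemma wp_precision_loop b O io n rows D cnt z q r i y acc G (Z : nat) l g
    (Q : seq tree -> Prop) : (16 * Z + 16 < b)%N ->
  (forall k, (8 * Z + 8 <= 2 ^ k <= 16 * Z + 16)%N ->
    Q [:: io; n; rows; Int k; Int (2 ^ k)%N; D; cnt; z; q; r; i; y; acc; G; Int Z; l; g]) ->
  wp b O precision_loop
    [:: io; n; rows; Int 3; Int 8; D; cnt; z; q; r; i; y; acc; G; Int Z; l; g] Q.
Proof.
move=> Zb hQ; have b0 : (0 < b)%N by apply: leq_ltn_trans Zb.
(* A variant linear in Z is far above the logarithmic number of doublings, but time polynomial in
   1/eta is allowed. *)
pose I c L := exists k, [/\ (2 ^ k <= 16 * Z + 16)%N, (8 * Z + 8 - 2 ^ k = c)%N &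
  L = [:: io; n; rows; Int k; Int (2 ^ k)%N; D; cnt; z; q; r; i; y; acc; G; Int Z; l; g]].
apply: (@wp_while _ _ b0 I _ _ _ (8 * Z + 8 - 8)%N).
- by exists 3%N; split=> //; lia.
- by lia.
- by move=> c L [k [_ _ ->]].
- move=> c L [k [kZ kc ->]] /=; rewrite posz_bool => h.
  have k0 : (0 < 2 ^ k)%N by rewrite expn_gt0.
  have kk := ltn_expl k (isT : (1 < 2)%N).
  apply: wp_seq => //; apply: wp_assign => //=.
    by move=> _; apply: bitlen_leq_abs; lia.
  apply: wp_assign => //=; first by move=> _; apply: bitlen_leq_abs; lia.
  exists (8 * Z + 8 - 2 ^ k.+1)%N; first by rewrite expnS; lia.
  exists k.+1; split=> //; first by rewrite expnS; lia.
  by rewrite -!PoszD addn1 expnS mul2n addnn.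
- move=> c L [k [kZ kc ->]] /=; rewrite posz_bool => h.
  by apply: hQ; lia.
Qed.

(** * The predictor *)

Lemma fracv_add_mul (R : realType) (x y z : int * int) :
  0 < x.2 -> 0 < y.2 -> 0 < z.2 ->
  fracv R (x.1 * (y.2 * z.2) + x.2 * (y.1 * z.1), x.2 * (y.2 * z.2)) =
  fracv R x + fracv R y * fracv R z.
Proof.
case: x y z => [x x'] [y y'] [z z'] /= h1 h2 h3; rewrite /fracv /=.
rewrite rmorphD !rmorphM /=.
have : x'%:~R != 0 :> R by rewrite intr_eq0 gt_eqF.
have : y'%:~R != 0 :> R by rewrite intr_eq0 gt_eqF.
have : z'%:~R != 0 :> R by rewrite intr_eq0 gt_eqF.
move: (x'%:~R) (y'%:~R) (z'%:~R) => u v w w0 v0 u0.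
by field; rewrite w0 v0 u0.
Qed.

Section Predictor.
Variables (R : realType) (b be : nat) (O : nat -> nat -> int) (a : com) (nn : nat).
Variables (E : tree) (rs : seq (int * int)) (F : nat -> R).
Hypothesis ab : (cbits a <= be)%N.
Hypothesis rs_pos : all (fun r : int * int => 0 < r.2) rs.
Hypothesis rs_bits : all (fun r : int * int => tbits (enc_frac r) <= be)%N rs.
Hypothesis nb : (bitlen nn <= be)%N.
Hypothesis Eb : (tbits E <= be)%N.
Hypothesis sb : (size rs < be)%N.
Hypothesis F_run : forall l, (l < size rs)%N -> exists v t,
  [/\ runs no_reals a (enc_seq [:: enc_nat nn; enc_nat l; E]) v t,
    is_value v (F l) & (t <= be)%N].
Hypothesis bE : ((size rs).+1 * (2 * be * (size rs).+1 + 4 * be + 2) <= b)%N.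

Let dft : int * int := (0, 1).

(** Fractions are added without reduction. The denominator gains at most 2 be bits per round, and
    the numerator at most the length of the denominator plus 4 be, so both lengths stay
    polynomial. *)
Lemma wp_predict_loop io g (Q : seq tree -> Prop) :
  (forall w l A B g', 0 < B ->
     fracv R (A, B) = \sum_(i < size rs) fracv R (nth dft rs i) * F i ->
     Q [:: io; enc_nat nn; w; E; l; Int A; Int B; g']) ->
  wp b O (predict_loop a) [:: io; enc_nat nn; enc_seq [seq enc_frac r | r <- rs];
    E; Int 0; Int 0; Int 1; g] Q.
Proof.
move=> hQ; set s := size rs.
have be_b : (be <= b)%N.
  apply: leq_trans bE; rewrite mulSn; apply: leq_trans (leq_addr _ _).
  by rewrite -addnA; apply: leq_trans (leq_addl _ _); lia.
have sbb : (s < b)%N by apply: leq_trans be_b.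
have b0 : (0 < b)%N by apply: leq_ltn_trans sbb.
have be0 : (0 < be)%N by apply: leq_ltn_trans sb.
pose I c L := exists j A B g', [/\ [/\ (j + c)%N = s, 0 < B,
    (bitlen A <= 1 + j * (2 * be * s + 4 * be + 1))%N & (bitlen B <= 1 + j * (2 * be))%N],
  fracv R (A, B) = \sum_(i < j) fracv R (nth dft rs i) * F i &
  L = [:: io; enc_nat nn; enc_seq (drop j [seq enc_frac r | r <- rs]);
    E; Int j; Int A; Int B; g']].
apply: (@wp_while _ _ b0 I _ _ _ s).
- exists 0%N, 0, 1, g; split=> //; last by rewrite drop0.
  by rewrite big_ord0 /fracv /= mul0r.
- exact: ltnW.
- by move=> c L [j [A [B [g' [_ _ ->]]]]].
- move=> c L [j [A [B [g' [[jc B0 Ab Bb] AB ->]]]]] /=.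
  rewrite posz_bool is_pair_enc size_drop size_map -/s => jq.
  have {}jq : (j < s)%N by lia.
  have [v [t [hv [r r0 [Ev EF]] tb]]] := F_run jq.
  have rb : (tbits v <= be)%N.
    case: (hv) => u [hu <-]; apply: (tbits_exec hu) => // x.
    rewrite /upd; case: eqP => // _.
    have lb : (tbits (enc_nat j) <= be)%N.
      by apply: bitlen_leq_abs; apply: leq_trans sb; exact: ltnW.
    by rewrite /= !geq_max nb lb Eb.
  pose x := nth dft rs j.
  have x0 : 0 < x.2 by apply: (allP rs_pos); apply: mem_nth.
  have xb : (tbits (enc_frac x) <= be)%N by apply: (allP rs_bits); apply: mem_nth.
  have -> : enc_seq (drop j [seq enc_frac r | r <- rs]) =
      Pair (enc_frac x) (enc_seq (drop j.+1 [seq enc_frac r | r <- rs])).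
    by rewrite (drop_nth (Int 0)) ?size_map // (nth_map dft).
  move: rb xb; rewrite Ev /= !geq_max => /andP[r1b r2b] /andP[x1b x2b].
  pose A' := A * (x.2 * r.2) + B * (x.1 * r.1).
  pose B' := B * (x.2 * r.2).
  have jle : (j * (2 * be) <= 2 * be * s)%N by rewrite mulnC leq_mul2l ltnW ?orbT.
  have mulb u y z : (bitlen y <= be -> bitlen z <= be ->
      bitlen (u * (y * z))%R <= bitlen u + (be + be))%N.
    move=> yb zb; apply: leq_trans (bitlenM _ _) _; rewrite leq_add2l.
    exact: leq_trans (bitlenM _ _) (leq_add yb zb).
  have B'b : (bitlen B' <= 1 + j.+1 * (2 * be))%N.
    by apply: leq_trans (mulb B _ _ x2b r2b) _; rewrite mulSn; lia.
  have A'b : (bitlen A' <= 1 + j.+1 * (2 * be * s + 4 * be + 1))%N.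
    apply: leq_trans (bitlenD _ _) _.
    apply: leq_trans (leq_add (mulb A _ _ x2b r2b) (mulb B _ _ x1b r1b)) _.
    by rewrite mulSn; lia.
  have top i m : (i <= s -> m <= 2 * be * s + 4 * be + 1 -> 1 + i * m <= b)%N.
    move=> is_ mle; apply: leq_trans bE; rewrite mulSn; apply: leq_add; first by lia.
    by apply: leq_mul => //; apply: leq_trans mle _; rewrite -/s mulnS; lia.
  apply: wp_seq => //; apply: (@wp_call _ _ b0 _ _ _ _ _ _ v t) => //=.
  + exact: leq_trans tb be_b.
  + exact: leq_trans ab be_b.
  rewrite Ev.
  apply: wp_seq => //; apply: wp_assign => //=.
    by move=> _; apply: leq_trans A'b _; apply: top.
  apply: wp_seq => //; apply: wp_assign => //=.
    by move=> _; apply: leq_trans B'b _; apply: top => //; lia.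
  apply: wp_seq => //; apply: wp_move => //=.
  apply: wp_assign => //=.
    by move=> _; apply: bitlen_leq_abs; lia.
  exists c.-1; first by lia.
  exists j.+1, A', B', (enc_frac r); split => //; last by rewrite -PoszD addn1.
    by split=> //; [lia|rewrite /B' !mulr_gt0].
  rewrite big_ord_recr /= -AB EF -/x.
  exact: (@fracv_add_mul R (A, B)).
- move=> c L [j [A [B [g' [[jc B0 Ab Bb] AB ->]]]]] /=.
  rewrite posz_bool is_pair_enc size_drop size_map -/s => jq.
  have js : j = s by lia.
  by apply: hQ => //; rewrite AB js.
Qed.

Lemma predictor_run : exists v t,
  [/\ runs O (predictor a)
      (enc_seq [:: enc_nat nn; enc_seq [seq enc_frac r | r <- rs]; E]) v t,
    is_value v (\sum_(i < size rs) fracv R (nth dft rs i) * F i) &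
    (t <= weight (predictor a) * b ^ weight (predictor a))%N].
Proof.
have be_b : (be <= b)%N.
  apply: leq_trans bE; rewrite mulSn; apply: leq_trans (leq_addr _ _).
  by rewrite -addnA; apply: leq_trans (leq_addl _ _); lia.
have b0 : (0 < b)%N by apply: leq_trans be_b; lia.
set w := enc_seq _.
have wb : (tbits w <= b)%N.
  rewrite /w /= !geq_max; apply/and4P; split => //.
  - exact: leq_trans nb be_b.
  - elim: rs rs_bits => //= r l IH /andP[rb /IH lb].
    by rewrite !geq_max in rb *; case/andP: rb => /leq_trans -> // /leq_trans ->.
  - exact: leq_trans Eb be_b.
have [|v [t [h1 h2 _ h3]]] := @wp_runs b O (predictor a) w 7
  (fun v => is_value v (\sum_(i < size rs) fracv R (nth dft rs i) * F i)) b0 wb.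
  do 6!(apply: wp_seq => //; apply: wp_move => //=).
  apply: wp_seq => //; apply: wp_predict_loop => u l A B g B0 AB.
  apply: wp_move => //=; eexists _, _; split; first by [].
  by exists (A, B).
by exists v, t.
Qed.

End Predictor.

(** * Polynomial bounds *)

Definition poly_bounded (F : nat -> nat) :=
  exists c : nat, forall x, (F x <= c * x.+1 ^ c)%N.

Lemma leq_pow c d x : (c <= d)%N -> (c * x.+1 ^ c <= d * x.+1 ^ d)%N.
Proof. by move=> cd; apply: leq_mono. Qed.

Lemma poly_bounded_const m : poly_bounded (fun=> m).
Proof. by exists m => x; rewrite leq_pmulr // expn_gt0. Qed.

Lemma poly_bounded_id : poly_bounded id.
Proof. by exists 1%N => x; rewrite mul1n expn1. Qed.

Lemma poly_boundedD F G : poly_bounded F -> poly_bounded G ->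
  poly_bounded (fun x => F x + G x)%N.
Proof.
move=> [c hc] [d hd]; exists (c + d)%N => x; rewrite mulnDl.
by apply: leq_add; [apply: leq_trans (hc x) _|apply: leq_trans (hd x) _];
  rewrite leq_mul // leq_pexp2l // ?leq_addr ?leq_addl.
Qed.

Lemma poly_boundedM F G : poly_bounded F -> poly_bounded G ->
  poly_bounded (fun x => F x * G x)%N.
Proof.
move=> [c hc] [d hd]; exists (c * d + (c + d))%N => x.
apply: leq_trans (leq_mul (hc x) (hd x)) _; rewrite mulnACA -expnD.
by rewrite leq_mul ?leq_addr // leq_pexp2l // leq_addl.
Qed.

Lemma poly_bounded_exp F m : poly_bounded F -> poly_bounded (fun x => F x ^ m)%N.
Proof.
move=> hF; elim: m => [|m IH]; first exact: (poly_bounded_const 1).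
have [c hc] := poly_boundedM hF IH.
by exists c => x; rewrite expnS.
Qed.

Lemma poly_boundedS F : poly_bounded F -> poly_bounded (fun x => (F x).+1).
Proof.
move=> hF; have [c hc] := poly_boundedD hF (poly_bounded_const 1).
by exists c => x; rewrite -addn1.
Qed.

Create HintDb poly.
#[local] Hint Resolve poly_bounded_const poly_bounded_id poly_boundedD
  poly_boundedM poly_boundedS poly_bounded_exp : poly.

(** * Rounding *)

(** This ties the integer division done by the program to the real floor: both round down, as the
    denominator is positive. *)
Lemma floor_fracv (R : realType) (P : nat) (r : int * int) : 0 < r.2 ->
  Num.floor (P%:R * fracv R r) = (P%:Z * r.1 %/ r.2)%Z.
Proof.
move=> r0; apply: Num.Theory.floor_def.
have rR : 0 < r.2%:~R :> R by rewrite ltr0z.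
have -> : P%:R * fracv R r = (P%:Z * r.1)%:~R / r.2%:~R.
  by rewrite rmorphM /= /fracv mulrA.
have [h1 h2] : ((P%:Z * r.1 %/ r.2)%Z * r.2 <= P%:Z * r.1) /\
    (P%:Z * r.1 < ((P%:Z * r.1 %/ r.2)%Z + 1) * r.2).
  have := divz_eq (P%:Z * r.1) r.2; have := modz_ge0 (P%:Z * r.1) (lt0r_neq0 r0).
  have := ltz_pmod (P%:Z * r.1) r0.
  move: (P%:Z * r.1) => x h1 h2 h3; rewrite mulrDl mul1r {2 3}h3; split; lia.
rewrite ler_pdivlMr // ltr_pdivrMr // -!rmorphM /= ler_int ltr_int.
by rewrite h1 h2.
Qed.

Lemma floor_bounds (R : realType) (x : R) :
  (Num.floor x)%:~R <= x /\ x <= (Num.floor x)%:~R + 1.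
Proof.
split; first exact: floor_le.
by apply: ltW; rewrite -[1]/(1%:~R) -rmorphD /= floorD1_gt.
Qed.

Lemma floor_01 (R : realType) (P : nat) (x : R) : 0 <= x <= 1 ->
  0 <= Num.floor (P%:R * x) <= P%:Z.
Proof.
case/andP=> x0 x1; rewrite floor_ge0 mulr_ge0 //=.
have <- : Num.floor (P%:R : R) = P%:Z by rewrite -(intrKfloor (R := R) P%:Z).
by apply: le_floor; rewrite ler_piMr.
Qed.

(* D y and P d differ by roundings and S is close to D, so P A and P d S differ by
   at most 4 D + S <= 7 S. *)
Lemma normalization_error (R : realFieldType) (S D P y d eta A G : R) :
  `|S * P - D * P| <= 2 * D -> `|G - D * y| <= 2 * D ->
  G <= P * A -> P * A <= G + S -> y <= P * d -> P * d <= y + 1 ->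
  0 <= y -> y <= P -> 8 <= P -> 8 <= eta * P -> 0 < D ->
  [/\ 0 < S, S <= 2 * D & `|A / S - d| <= eta].
Proof.
rewrite !ler_norml => /andP[a1 a2] /andP[b1 b2] g1 g2 y1 y2 y0 yP P8 eP D0.
have P0 : 0 < P by lra.
(* The normalization constraint and P >= 8 give |S - D| <= 2 D / P <= D / 4. *)
have SD1 : 3 * D <= 4 * S.
  by rewrite -(ler_pM2r P0); nra.
have S0 : 0 < S by lra.
have SD2 : S <= 2 * D by rewrite -(ler_pM2r P0); nra.
split=> //.
(* Normalization bounds P |S - D| by 2 D, and 0 <= y <= P lets y take the place of P. *)
have yDS : `|y * (D - S)| <= 2 * D.
  rewrite normrM (ger0_norm y0); apply: le_trans (_ : P * `|D - S| <= _).
    by rewrite ler_wpM2r.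
  by rewrite -[X in X * _]gtr0_norm // -normrM ler_norml; apply/andP; split; lra.
move: yDS; rewrite ler_norml => /andP[z1 z2].
have -> : A / S - d = (A - d * S) / S by field; apply: lt0r_neq0.
rewrite ler_pdivlMr // ler_pdivrMr // -(ler_pM2l P0) -[X in _ && X](ler_pM2l P0).
have e1 : 8 * S <= P * (eta * S) by nra.
have yS : y * S <= P * (d * S) by nra.
have yS' : P * (d * S) <= y * S + S by nra.
rewrite !mulrBr mulNr mulrN; apply/andP; split; lra.
Qed.

(** Programs know ontic states only by index; extension by 0 beyond |L| gives a function on all of
    nat, independent of the guess s. *)
Definition by_rank (R : nmodType) (L : finType) (h : L -> R) (l : nat) : R :=
  if insub l is Some i then h (enum_val (i : 'I_#|L|)) else 0.

Lemma by_rank_rank (R : nmodType) (L : finType) (h : L -> R) x :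
  by_rank h (enum_rank x) = h x.
Proof. by rewrite /by_rank valK enum_rankK. Qed.

Lemma rank_onto (L : finType) l : (l < #|L|)%N -> exists x : L, enum_rank x = l :> nat.
Proof. by move=> lL; exists (enum_val (Ordinal lL)); rewrite enum_valK. Qed.

Lemma sum_by_rank (R : nmodType) (L : finType) (h : L -> R) :
  \sum_x h x = \sum_(i < #|L|) by_rank h i.
Proof.
rewrite (reindex (@enum_rank L)) /=; last first.
  by exists enum_val => x _; rewrite ?enum_rankK ?enum_valK.
by apply: eq_bigr => x _; rewrite by_rank_rank.
Qed.

Lemma by_rankM (R : nzRingType) (L : finType) (h h' : L -> R) l :
  by_rank (fun x => h x * h' x) l = by_rank h l * by_rank h' l.
Proof. by rewrite /by_rank; case: insub => [i|]; rewrite ?mul0r. Qed.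

Lemma by_rank_ge0 (R : numDomainType) (L : finType) (h : L -> R) l :
  (forall x, 0 <= h x) -> 0 <= by_rank h l.
Proof. by move=> h0; rewrite /by_rank; case: insub => [i|]. Qed.

(** An explicit choice of b, with s >= |L|, N above n, m and floor(1/eta), ta the time for f and ca
    its constants. It is built from sums and products only, so that its polynomial growth follows
    structurally. *)
Definition learner_bound (s N ta ca : nat) : nat :=
  let P := (16 * N + 16)%N in
  let D := (s * P ^ 2)%N in
  (s * (D * P * P) + D * P + D * P + D * 2 + P + P + s + 8
   + ((s * (D + 1) + D) * (N + 3) + (N + 1))
   + (ta + ca + N + (16 * N + 16) + 4))%N.

Lemma learner_bound_large s s' N ta ca P m k :
  (s' <= s)%N -> (P <= 16 * N + 16)%N -> (m <= N)%N -> (k < P)%N ->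
  (s' * (s' * P ^ 2 * P * P) + s' * P ^ 2 * P + s' * P ^ 2 * P + s' * P ^ 2 * 2
     + P + k + s' + 8 < learner_bound s N ta ca)%N /\
  ((s' * (s' * P ^ 2).+1 + s' * P ^ 2) * m.+3 + m.+1 <= learner_bound s N ta ca)%N.
Proof.
move=> ss PN mN kP; rewrite /learner_bound; set Q := (16 * N + 16)%N in PN *.
have DD : (s' * P ^ 2 <= s * Q ^ 2)%N by rewrite leq_mul // leq_sqr.
set D := (s * Q ^ 2)%N in DD *; set D' := (s' * P ^ 2)%N in DD *.
have DQ : (D' * P <= D * Q)%N by rewrite leq_mul.
have h1 : (s' * (D' * P * P) <= s * (D * Q * Q))%N by rewrite !leq_mul.
have h2 : ((s' * D'.+1 + D') * m.+3 <= (s * (D + 1) + D) * (N + 3))%N.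
  by rewrite leq_mul ?leq_add ?leq_mul //; lia.
move: (s' * (D' * P * P))%N (s * (D * Q * Q))%N (D' * P)%N (D * Q)%N h1 h2 DQ.
move: ((s' * D'.+1 + D') * m.+3)%N ((s * (D + 1) + D) * (N + 3))%N.
by move=> u1 u2 u3 u4 u5 u6 h1 h2 DQ; split; lia.
Qed.

Lemma wp_learner b (O : nat -> nat -> int) a (nn Z : nat) Es (Q : seq tree -> Prop) :
  O 0%N 0%N = Z -> (cbits a <= b)%N -> (16 * Z + 16 < b)%N ->
  (forall k, (8 * Z + 8 <= 2 ^ k <= 16 * Z + 16)%N -> forall io z D cnt q r i y acc G t l g,
    wp b O (search a) [:: io; enc_nat nn; Pair (Int 1) Es; Int k; Int (2 ^ k)%N; D;
      cnt; z; q; r; i; y; acc; G; t; l; g] Q) ->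
  wp b O (learner a) (enc_seq [:: enc_nat nn; Es] :: nseq 16 (Int 0)) Q.
Proof.
move=> EZ ab bZ hQ; have b0 : (0 < b)%N by lia.
rewrite [nseq _ _]/=.
apply: wp_seq => //; apply: wp_move => //=.
apply: wp_seq => //; apply: wp_move => //=.
apply: wp_seq => //; apply: wp_assign => //=.
  by move=> _; apply: bitlen_leq_abs; lia.
apply: wp_seq => //; apply: wp_assign => //=.
  by move=> _; apply: bitlen_leq_abs; lia.
apply: wp_seq => //; apply: wp_get => //=; rewrite EZ.
  by apply: bitlen_leq_abs; lia.
by apply: wp_seq => //; apply: wp_precision_loop bZ _ => k kZ; apply: hQ.
Qed.

(** * Correctness of the learner *)

Section LearnerSpec.
Variables (R : realType) (L : finType) (pr : L -> R) (a : com) (nn s N ta : nat).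
(** A measurement is reduced to its code and its outcome function on L, so no matrices occur
    here. *)
Variables (eta : R) (Es : seq (tree * (L -> R))).
Hypothesis pr_prep : preparation pr.
Hypothesis eta_gt0 : 0 < eta.
Let d (phi : L -> R) := \sum_x pr x * phi x.
Let Z := `|Num.floor eta^-1|%N.
Let es i := nth (Int 0, fun=> 0) Es i.
Hypothesis Es_tree : forall i, (i < size Es)%N ->
  int_of (es i).1 = 0 /\ (tbits (es i).1 <= 1)%N.
Hypothesis Es_01 : forall i, (i < size Es)%N -> forall x, 0 <= (es i).2 x <= 1.
Hypothesis Es_run : forall i, (i < size Es)%N -> forall x,
  exists v t, [/\ runs no_reals a
    (enc_seq [:: enc_nat nn; enc_nat (enum_rank x); (es i).1]) v t,
    is_value v ((es i).2 x) & (t <= ta)%N].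
Hypotheses (sL : (#|L| <= s)%N) (mN : (size Es <= N)%N) (ZN : (Z <= N)%N)
  (nN : (nn <= N)%N).

Variable b : nat.
Hypothesis b_large : (learner_bound s N ta (cbits a) <= b)%N.
Let b_large' : (ta + cbits a + N + (16 * N + 16) + 4 <= b)%N.
Proof. exact: leq_trans (leq_addl _ _) b_large. Qed.

Let O := real_inputs (eta^-1 :: [seq d e.2 | e <- Es]).

Let L_gt0 : (0 < #|L|)%N.
Proof.
case: (posnP #|L|) => // L0; have [_] := pr_prep.
rewrite big_pred0 => [/esym/eqP|x]; first by rewrite oner_eq0.
by have := card0_eq L0 x.
Qed.

Lemma d_01 i : (i < size Es)%N -> 0 <= d (es i).2 <= 1.
Proof.
have [pr0 pr1] := pr_prep; move=> /Es_01 h; apply/andP; split.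
  by apply: sumr_ge0 => x _; rewrite mulr_ge0 //; case/andP: (h x).
by rewrite -pr1; apply: ler_sum => x _; rewrite ler_piMr //; case/andP: (h x).
Qed.

Lemma by_rank_01 i l : (i < size Es)%N -> 0 <= by_rank (es i).2 l <= 1.
Proof.
by move=> /Es_01 h; rewrite /by_rank; case: insub => // ; rewrite lexx ler01.
Qed.

Let rows_of (P : nat) : seq row :=
  Row (Int 1) P (fun=> P%:Z) ::
  [seq Row e.1 (Num.floor (P%:R * d e.2)) (fun l => Num.floor (P%:R * by_rank e.2 l))
    | e <- Es].

Let nth_rows dfl P i : (i < size Es)%N -> nth dfl (rows_of P) i.+1 =
  Row (es i).1 (Num.floor (P%:R * d (es i).2))
    (fun l => Num.floor (P%:R * by_rank (es i).2 l)).
Proof. by move=> im; rewrite /= (nth_map (Int 0, fun=> 0)). Qed.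

Let Z_floor : Posz Z = Num.floor eta^-1.
Proof. by rewrite /Z gez0_abs // floor_ge0 invr_ge0 ltW. Qed.

Lemma rows_of_ok k dfl i : (i < size (rows_of (2 ^ k)))%N ->
  row_ok b O a nn k #|L| (2 ^ k) i (nth dfl (rows_of (2 ^ k)) i).
Proof.
case: i => [_|i im] /=.
  by split=> /= [l _||]; rewrite ?lexx ?andbT //; left.
have {}im : (i < size Es)%N by rewrite /= size_map in im.
rewrite (nth_map (Int 0, fun=> 0)) //; split=> /= [l _||].
- by apply: floor_01; apply: by_rank_01.
- by apply: floor_01; apply: d_01.
- right; have [E0 _] := Es_tree im; split=> // [|l lL].
    by rewrite /O /real_inputs /= (nth_map (Int 0, fun=> 0)) // natrX.
  have [x xl] := rank_onto lL; have [v [t [hv [[num den] r0 [Ev Ex]] tb]]] := Es_run im x.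
  exists num, den, t; rewrite xl Ev in hv; split=> //.
    by apply: leq_trans tb _; lia.
  by rewrite -xl by_rank_rank -/(es i) Ex floor_fracv.
Qed.

(** Rounding the outcomes lowers the weighted sum by at most the total mass 1, and rounding the
    datum lowers it by at most 1. Both errors go downwards, so their difference is at most 1 and not
    2. *)
Lemma rows_of_feasible P dfl i : (i < size (rows_of P))%N ->
  `|\sum_(j < #|L|) by_rank pr j * (rcoef (nth dfl (rows_of P) i) j)%:~R
    - (rval (nth dfl (rows_of P) i))%:~R| <= 1.
Proof.
have [pr0 pr1] := pr_prep.
case: i => [_|i im] /=.
  by rewrite -mulr_suml -sum_by_rank pr1 mul1r subrr normr0.
have {}im : (i < size Es)%N by rewrite /= size_map in im.
rewrite (nth_map (Int 0, fun=> 0)) //= -/(es i).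
have -> : d (es i).2 = \sum_(j < #|L|) by_rank pr j * by_rank (es i).2 j.
  by rewrite /d sum_by_rank; apply: eq_bigr => j _; rewrite by_rankM.
set X := \sum_(j < _) _ * _%:~R; set Y := \sum_(j < _) _.
have XY : X <= P%:R * Y.
  rewrite mulr_sumr; apply: ler_sum => j _; rewrite mulrCA.
  by rewrite ler_wpM2l ?by_rank_ge0 //; have [] := floor_bounds (P%:R * by_rank (es i).2 j).
have YX : P%:R * Y <= X + 1.
  have p1 : \sum_(j < #|L|) by_rank pr j = 1 by rewrite -sum_by_rank.
  rewrite -[X in _ <= _ + X]p1 mulr_sumr -big_split; apply: ler_sum => j _ /=.
  rewrite mulrCA -[X in _ + X]mulr1 -mulrDr.
  by rewrite ler_wpM2l ?by_rank_ge0 //; have [] := floor_bounds (P%:R * by_rank (es i).2 j).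
have [] := floor_bounds (P%:R * Y); move: (P%:R * Y) XY YX => W XY YX f1 f2.
by rewrite ler_norml; apply/andP; split; lra.
Qed.

(** The bound on S, which is 2 D with P replaced by its largest possible value, is what keeps the
    description short. *)
Definition learned (w : tree) (q : seq int) :=
  let S := \sum_(i < size q) q`_i in
  [/\ w = enc_normalized q, (0 < size q <= #|L|)%N,
    0 < S /\ forall j, 0 <= q`_j,
    S <= (2 * (size q * (16 * Z + 16) ^ 2))%N%:Z &
    forall i, (i < size Es)%N ->
      `|(\sum_(j < size q) (q`_j)%:~R * by_rank (es i).2 j) / S%:~R - d (es i).2| <= eta].

Lemma satisfied_learned k D q dfl : (8 * Z + 8 <= 2 ^ k <= 16 * Z + 16)%N ->
  (0 < size q <= #|L|)%N -> D = (size q * (2 ^ k) ^ 2)%N -> (forall j, 0 <= q`_j) ->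
  (forall j, (j < size (rows_of (2 ^ k)))%N ->
     satisfied D q (nth dfl (rows_of (2 ^ k)) j)) ->
  learned (enc_normalized q) q.
Proof.
move=> /andP[kZ1 kZ2] q_size DE q0 sat.
set P := (2 ^ k)%N in kZ1 kZ2 DE sat.
have P0 : (0 < P)%N by rewrite expn_gt0.
have D0 : (0 < D)%N by rewrite DE muln_gt0 expn_gt0 P0 andbT; case/andP: q_size.
pose S := \sum_(i < size q) q`_i.
have satR r : satisfied D q r ->
    `|(dot (rcoef r) q)%:~R - D%:R * (rval r)%:~R| <= 2 * D%:R :> R.
  rewrite /satisfied -lez_nat abszE PoszM -(ler_int R) intr_norm rmorphB !rmorphM /=.
  by [].
have hS : `|S%:~R * P%:R - D%:R * P%:R| <= 2 * D%:R :> R.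
  by have /satR := sat 0%N isT; rewrite /= /dot -mulr_suml rmorphM.
have P8 : 8 <= P%:R :> R by rewrite (ler_nat R 8); lia.
have eP : 8 <= eta * P%:R.
  have : eta^-1 <= (Z%:R + 1 : R).
    have [_] := floor_bounds eta^-1; by rewrite -Z_floor.
  rewrite -(ler_pM2l eta_gt0) mulfV ?gt_eqF // => h.
  have h2 : 8 * (Z%:R + 1) <= P%:R :> R.
    by rewrite -[1]/(1%:R) -natrD -natrM ler_nat; lia.
  have := ler_wpM2l (ltW eta_gt0) h2; rewrite mulrCA; lra.
have D0R : 0 < D%:R :> R by rewrite ltr0n.
have main i : (i < size Es)%N -> [/\ 0 < S%:~R :> R, S%:~R <= 2 * D%:R :> R &
    `|(\sum_(j < size q) (q`_j)%:~R * by_rank (es i).2 j) / S%:~R - d (es i).2| <= eta].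
  move=> im; have im' : (i.+1 < size (rows_of P))%N by rewrite /= size_map.
  have /satR := sat i.+1 im'; rewrite nth_rows //= => h.
  have [f1 f2] := floor_bounds (P%:R * d (es i).2).
  have /andP[y0 yP] := floor_01 P (d_01 im).
  apply: (normalization_error hS h) => //; rewrite ?ler0z //.
  - rewrite /dot rmorph_sum mulr_sumr; apply: ler_sum => j _.
    rewrite rmorphM /= mulrCA ler_wpM2l ?ler0z //.
    by have [] := floor_bounds (P%:R * by_rank (es i).2 j).
  - rewrite /dot /S !rmorph_sum mulr_sumr -big_split; apply: ler_sum => j _ /=.
    rewrite rmorphM /= mulrCA -[X in _ + X]mulr1 -mulrDr ler_wpM2l ?ler0z //.
    by have [] := floor_bounds (P%:R * by_rank (es i).2 j).
  - by rewrite (ler_int R _ P%:Z).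
(* The training set may be empty, so S > 0 is obtained from the normalization row alone, by taking a
   trivial datum. *)
have [S0 SD] : 0 < S%:~R :> R /\ S%:~R <= 2 * D%:R :> R.
  have [||||||||||] := @normalization_error R S%:~R D%:R P%:R 0 0 eta 0 0 hS;
    rewrite ?mulr0 ?subr0 ?normr0 ?mulr_ge0 ?ler0n ?add0r ?ler01 ?ler0z //.
  by apply: sumr_ge0.
split=> //; rewrite -/S.
- by split=> //; rewrite -(ltr0z R).
- rewrite -(ler_int R); apply: le_trans SD _; rewrite -natrM ler_nat leq_mul2l DE.
  by rewrite leq_mul2l leq_sqr kZ2 !orbT.
- by move=> i im; have [] := main i im.
Qed.

Lemma learner_runs : exists w t q,
  [/\ runs O (learner a) (enc_seq [:: enc_nat nn; enc_seq [seq e.1 | e <- Es]]) w t,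
    (t <= weight (learner a) * b ^ weight (learner a))%N & learned w q].
Proof.
have b0 : (0 < b)%N by lia.
set inp := enc_seq _.
have inpb : (tbits inp <= b)%N.
  rewrite /inp /= !geq_max b0; apply/and3P; split=> //.
    by apply: bitlen_leq_abs; lia.
  have : forall i, (i < size Es)%N -> (tbits (es i).1 <= 1)%N.
    by move=> i /Es_tree[].
  rewrite /es; elim: (Es) => [//|e l IH] h /=.
  rewrite geq_max (leq_trans (h 0%N isT)) //=; apply: IH => i il; exact: (h i.+1).
have [|w [t [h1 h2 _ [q lq]]]] := @wp_runs b O (learner a) inp 16
  (fun w => exists q, learned w q) b0 inpb; last by exists w, t, q.
have EZ : O 0%N 0%N = Z by rewrite Z_floor /O /real_inputs /= expr0 mul1r.
apply: wp_learner EZ _ _ _; [lia|lia|move=> k kZ io z D cnt q r i y acc G t l g].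
have PN : (2 ^ k <= 16 * N + 16)%N by lia.
have P0 : (0 < 2 ^ k)%N by rewrite expn_gt0.
have kP := ltn_expl k (isT : (1 < 2)%N).
rewrite -[Pair (Int 1) _]/(enc_seq (Int 1 :: [seq e.1 | e <- Es])).
have -> : Int 1 :: [seq e.1 | e <- Es] = [seq rtree r | r <- rows_of (2 ^ k)].
  by rewrite /= -map_comp; congr cons; apply: eq_map.
(* The number |L| enters as the s0 of the analysis only; the program does not receive it. *)
apply: (@wp_search b O a nn k #|L| (2 ^ k) b0 _ (#|L| * (2 ^ k) ^ 2)
  (#|L| * (2 ^ k) ^ 2 * 2 ^ k) _ _ _ R (by_rank pr)) => //.
- by lia.
- by apply: leq_trans b_large; have [] := learner_bound_large ta (cbits a) sL PN mN kP.
- by move=> j; apply: by_rank_ge0; case: pr_prep.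
- by rewrite -sum_by_rank; case: pr_prep.
- exact: rows_of_ok.
- exact: rows_of_feasible.
- by rewrite /= size_map; lia.
- apply: leq_trans b_large; rewrite /= size_map.
  by have [_] := learner_bound_large ta (cbits a) sL PN mN kP.
- move=> {D q}D q l' [h1 h2 h3 h4]; exists (enc_normalized q), l'; split=> //.
  by exists q; apply: satisfied_learned h2 h3 h4.
Qed.

End LearnerSpec.

(** * The learned preparation and the length of its description *)

Lemma vsize_enc_seq (l : seq tree) m :
  (forall i, (i < size l)%N -> (vsize (nth (Int 0%R) l i) <= m)%N) ->
  (vsize (enc_seq l) <= size l * m.+1 + 1)%N.
Proof.
elim: l => [|v l IH] h //=; have := h 0%N isT; have := IH (fun i il => h i.+1 il).
by rewrite /= mulSn; lia.
Qed.

Lemma size_vsize_enc_seq (l : seq tree) : (size l < vsize (enc_seq l))%N.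
Proof. by elim: l => //= v l IH; lia. Qed.

Lemma tbits_vsize v : (tbits v <= vsize v)%N.
Proof. by elim: v => //= u hu v hv; rewrite geq_max; lia. Qed.

Lemma sum_ord_trunc (R : nmodType) (F : nat -> R) m n : (m <= n)%N ->
  (forall i, (m <= i)%N -> F i = 0) -> \sum_(i < n) F i = \sum_(i < m) F i.
Proof.
move=> mn F0; rewrite -!(big_mkord xpredT) (big_cat_nat _ mn) //=.
by rewrite [X in _ + X]big_nat_cond [X in _ + X]big1 ?addr0 // => i /andP[/andP[mi _] _]; apply: F0.
Qed.

Lemma fracv_normalized (R : realType) (q : seq int) (S : int) i :
  fracv R (nth (0, 1) [seq (x, S) | x <- q] i) = (q`_i)%:~R / S%:~R.
Proof.
case: (ltnP i (size q)) => iq; first by rewrite (nth_map 0).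
by rewrite !nth_default ?size_map // /fracv /= !mul0r.
Qed.

Lemma response_describes (R : realType) (L : finType) (T : Type) (rs : seq (int * int))
    (q : L -> R) (f : L -> T -> R) (E : T) : (size rs <= #|L|)%N ->
  (forall x, q x = fracv R (nth (0, 1) rs (enum_rank x))) ->
  response q f E = \sum_(i < size rs) fracv R (nth (0, 1) rs i) * by_rank (f ^~ E) i.
Proof.
move=> rsL qE; rewrite /response sum_by_rank.
rewrite -(@sum_ord_trunc _ (fun i => fracv R (nth (0, 1) rs i) * by_rank (f ^~ E) i)
  _ _ rsL) => [|i ri]; last by rewrite nth_default // /fracv !mul0r.
apply: eq_bigr => i _; have [x <-] := rank_onto (ltn_ord i).
by rewrite !by_rank_rank qE.
Qed.

Section Learned.
Variables (R : realType) (L : finType) (pr : L -> R) (eta : R).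
Variables (Es : seq (tree * (L -> R))) (w : tree) (q : seq int).
Hypothesis eta_gt0 : 0 < eta.
Hypothesis wq : learned pr eta Es w q.

Let S := \sum_(i < size q) q`_i.

(** States beyond the final guess get the default weight 0 of [nth], which matches the omitted
    trailing zeros of a description. *)
Definition learned_prep (x : L) : R := (q`_(enum_rank x))%:~R / S%:~R.

Lemma learned_describes : describes w learned_prep.
Proof.
have [-> /andP[_ qL] [S0 q0] _ _] := wq.
exists [seq (x, S) | x <- q]; split.
- by rewrite /enc_normalized -map_comp.
- by rewrite size_map.
- by rewrite all_map; apply/allP => x _ /=.
- by move=> x; rewrite fracv_normalized.
Qed.

Lemma learned_preparation : preparation learned_prep.
Proof.
have [_ /andP[_ qL] [S0 q0] _ _] := wq; have SR : 0 < S%:~R :> R by rewrite ltr0z.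
split=> [x|]; first by rewrite divr_ge0 ?ler0z // ltW.
rewrite sum_by_rank.
rewrite (eq_bigr (fun i : 'I_ _ => (q`_i)%:~R / S%:~R)) => [|i _]; last first.
  by have [x <-] := rank_onto (ltn_ord i); rewrite by_rank_rank.
rewrite -mulr_suml (@sum_ord_trunc _ (fun i => (q`_i)%:~R) _ _ qL) => [|i qi]; last first.
  by rewrite nth_default.
by rewrite -rmorph_sum mulfV // gt_eqF.
Qed.

Lemma learned_response (T : Type) (f : L -> T -> R) (E : T) :
  response learned_prep f E =
  (\sum_(j < size q) (q`_j)%:~R * by_rank (f ^~ E) j) / S%:~R.
Proof.
have [_ /andP[_ qL] _ _ _] := wq.
rewrite (@response_describes _ _ _ [seq (x, S) | x <- q]) ?size_map //; last first.
  by move=> x; rewrite fracv_normalized.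
rewrite mulr_suml; apply: eq_bigr => i _.
by rewrite fracv_normalized mulrAC.
Qed.

Lemma learned_vsize k : 2%:R ^- k <= eta ->
  (vsize w <= #|L| * (2 * (#|L| + 2 * k + 11) + 2) + 1)%N.
Proof.
move=> keta; have [-> /andP[_ qL] [S0 q0] SZ _] := wq.
set Z := `|Num.floor eta^-1|%N in SZ.
have Zk : (Z <= 2 ^ k)%N.
  rewrite -lez_nat /Z gez0_abs ?floor_ge0 ?invr_ge0 ?(ltW eta_gt0) //.
  rewrite -(ler_int R); apply: le_trans (floor_le _) _.
  by rewrite -[X in _ <= X]/((2 ^ k)%:R) natrX -[_ ^+ _]invrK lef_pV2 ?posrE ?invr_gt0 ?exprn_gt0.
(* From 16 Z + 16 <= 2^(k+5) and |L| < 2^|L|, the sum S is below 2 * 2^|L| * 2^(2k+10), which is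
   2^m. *)
pose m := (#|L| + 2 * k + 11)%N.
have SM x : 0 <= x -> x <= S -> (bitlen x <= m)%N.
  move=> x0 xS; apply: bitlen_leq; first by rewrite /m; lia.
  apply: (@leq_ltn_trans (2 * (size q * (16 * Z + 16) ^ 2))).
    by rewrite -lez_nat gez0_abs ?(le_trans xS).
  have z5 : (16 * Z + 16 <= 2 ^ (k + 5))%N.
    by rewrite expnD; have := expn_gt0 2 k; lia.
  apply: (@leq_ltn_trans (2 * (#|L| * (2 ^ (k + 5)) ^ 2))).
    by rewrite leq_mul2l leq_mul // leq_sqr.
  have -> : (2 ^ m = 2 * (2 ^ #|L| * (2 ^ (k + 5)) ^ 2))%N.
    by rewrite -expnM -expnD -expnS; congr (_ ^ _)%N; rewrite /m; lia.
  by rewrite ltn_mul2l /= ltn_mul2r !expn_gt0 /= ltn_expl.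
apply: leq_trans (@vsize_enc_seq _ (2 * m).+1 _) _.
  move=> i; rewrite size_map => iq; rewrite (nth_map 0) //= -/S.
  rewrite ltnS mul2n -addnn leq_add ?(SM S (ltW S0)) //.
  apply: SM => //; rewrite /S (bigD1 (Ordinal iq)) //= lerDl.
  by apply: sumr_ge0.
by rewrite size_map leq_add2r leq_mul //; rewrite -/m; lia.
Qed.

End Learned.

(** * Polynomial bounds for the learner and the predictor *)

Lemma tbits_enc_bits u : (tbits (enc_bits u) <= 1)%N.
Proof. by elim: u => //= c l IH; rewrite geq_max IH; case: c. Qed.

Lemma tbits_enc_seq_all l m : (tbits (enc_seq l) <= m)%N -> all (fun v => tbits v <= m)%N l.
Proof. by elim: l => //= v l IH; rewrite geq_max => /andP[-> /IH]. Qed.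

Lemma natr_poly_le (R : realType) (t c n m Z : nat) (u : R) :
  (t <= c * (n + m + Z).+1 ^ c)%N -> Z%:R <= u ->
  t%:R <= c%:R * (n%:R + m%:R + u + 1) ^+ c.
Proof.
move=> tc Zu; apply: le_trans (_ : (c * (n + m + Z).+1 ^ c)%:R <= _).
  by rewrite ler_nat.
rewrite natrM natrX ler_wpM2l ?ler0n // lerXn2r ?nnegrE ?ler0n //.
  by rewrite !addr_ge0 ?ler0n // (le_trans _ Zu) ?ler0n.
by rewrite -addn1 !natrD lerD2r lerD2l.
Qed.

(* The accuracy eta enters the bit length of the description of q and the
   running time of L2 only through the number k of binary digits of eta, so
   that both are poly(n) whenever eta >= 2^-poly(n). *)
Theorem theorem5 (R : realType)
    (C M : forall n : nat, set (qmatrix R n))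
    (cdesc mdesc : forall n : nat, qmatrix R n -> seq bool)
    (L : nat -> finType)
    (f : forall n : nat, L n -> qmatrix R n -> R)
    (p : forall n : nat, qmatrix R n -> L n -> R)
    (C_states : forall n rho, C n rho -> is_state rho)
    (M_effects : forall n E, M n E -> is_effect E)
    (C_desc : forall n rho rho', C n rho -> C n rho' ->
      cdesc n rho = cdesc n rho' -> rho = rho')
    (M_desc : poly_descriptions M mdesc)
    (eom : efficient_ontological_model C M cdesc mdesc f p) :
  exists L1 L2 : com,
    (exists c : nat,
      forall (n : nat) (pr : L n -> R) (eta : R) (T : seq (qmatrix R n * R)),
        preparation pr -> 0 < eta -> training_set (M n) (@f n) pr T ->
        exists (w : tree) (t : nat) (q : L n -> R),
          [/\ learner_run mdesc L1 eta T w t,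
              t%:R <= c%:R * (n%:R + (size T)%:R + eta^-1 + 1) ^+ c,
              describes w q /\ preparation q,
              forall k : nat, 2%:R ^- k <= eta ->
                (vsize w <= c * (n + k).+1 ^ c)%N &
              forall Ed, Ed \in T ->
                `|response q (@f n) Ed.1 - Ed.2| <= eta])
    /\
    (exists c : nat,
      forall (n : nat) (pr : L n -> R) (eta : R) (T : seq (qmatrix R n * R))
             (w : tree) (t : nat) (q : L n -> R) (E : qmatrix R n),
        preparation pr -> 0 < eta -> training_set (M n) (@f n) pr T ->
        learner_run mdesc L1 eta T w t -> describes w q -> preparation q ->
        M n E ->
        exists (v : tree) (t' : nat),
          [/\ runs no_reals L2
                (enc_seq [:: enc_nat n; w; enc_bits (mdesc n E)]) v t',
              is_value v (response q (@f n) E) &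
              forall k : nat, 2%:R ^- k <= eta ->
                (t' <= c * (n + k).+1 ^ c)%N]).
Proof.
have [cs hs] := eom_size eom; have [a [ct ha]] := eom_outcome eom.
exists (learner a), (predictor a).
pose sz x := (cs * x.+1 ^ cs)%N; pose tm x := (ct * x.+1 ^ ct)%N.
have sz_poly : poly_bounded sz by rewrite /sz; auto with poly.
have tm_poly : poly_bounded tm by rewrite /tm; auto with poly.
have mono c x y : (x <= y)%N -> (c * x.+1 ^ c <= c * y.+1 ^ c)%N.
  by case: c => // c xy; rewrite leq_mul2l leq_exp2r ?ltnS.
have [c1 time1] : poly_bounded (fun x =>
    weight (learner a) * learner_bound (sz x) x (tm x) (cbits a) ^ weight (learner a))%N.
  by rewrite /learner_bound; auto 30 with poly.
have [c2 size1] : poly_bounded (fun x => sz x * (2 * (sz x + 2 * x + 11) + 2) + 1)%N.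
  by auto 30 with poly.
have part1 : forall (n : nat) (pr : L n -> R) (eta : R) (T : seq (qmatrix R n * R)),
    preparation pr -> 0 < eta -> training_set (M n) (@f n) pr T ->
    exists (w : tree) (t : nat) (q : L n -> R),
      [/\ learner_run mdesc (learner a) eta T w t,
          t%:R <= (c1 + c2)%N%:R * (n%:R + (size T)%:R + eta^-1 + 1) ^+ (c1 + c2),
          describes w q /\ preparation q,
          forall k : nat, 2%:R ^- k <= eta ->
            (vsize w <= (c1 + c2) * (n + k).+1 ^ (c1 + c2))%N &
          forall Ed, Ed \in T -> `|response q (@f n) Ed.1 - Ed.2| <= eta].
  move=> n pr eta T pr_prep eta0 hT.
  pose Es := [seq (enc_bits (mdesc n Ed.1), (@f n) ^~ Ed.1) | Ed <- T].
  pose dfl : tree * (L n -> R) := (Int 0, fun=> 0).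
  have sE : size Es = size T by rewrite size_map.
  have nthE i : (i < size Es)%N -> exists2 Ed, Ed \in T &
      nth dfl Es i = (enc_bits (mdesc n Ed.1), (@f n) ^~ Ed.1).
    rewrite sE => iT; exists (nth (0, 0) T i); first exact: mem_nth.
    by rewrite (nth_map (0, 0)).
  (* One natural number N stands for n, m and 1/eta together; the real bound is recovered at the end
     from Z <= 1/eta. *)
  set Z := `|Num.floor eta^-1|%N; pose N := (n + size T + Z)%N.
  have nN : (n <= N)%N by rewrite /N; lia.
  have sL : (#|L n| <= sz N)%N := leq_trans (hs n) (mono _ _ _ nN).
  have mN : (size Es <= N)%N by rewrite sE /N; lia.
  have ZN : (Z <= N)%N by rewrite /N; lia.
  have E_tree i : (i < size Es)%N -> int_of (nth dfl Es i).1 = 0 /\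
      (tbits (nth dfl Es i).1 <= 1)%N.
    by move=> /nthE[Ed _ ->]; split; [case: (mdesc n Ed.1)|exact: tbits_enc_bits].
  have E_01 i : (i < size Es)%N -> forall x, 0 <= (nth dfl Es i).2 x <= 1.
    move=> /nthE[Ed EdT ->] x; have [ME _] := hT _ EdT.
    exact: om_outcome (eom_model eom n) x _ ME.
  have E_run i : (i < size Es)%N -> forall x, exists v t, [/\ runs no_reals a
      (enc_seq [:: enc_nat n; enc_nat (enum_rank x); (nth dfl Es i).1]) v t,
      is_value v ((nth dfl Es i).2 x) & (t <= tm N)%N].
    move=> /nthE[Ed EdT ->] x; have [ME _] := hT _ EdT.
    have [v [t [hv vx tb]]] := ha n x _ ME.
    by exists v, t; split=> //; apply: leq_trans tb (mono _ _ _ nN).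
  have [w [t [q [run tb lq]]]] := learner_runs pr_prep eta0 E_tree E_01 E_run sL mN ZN nN
    (leqnn _).
  have dE Ed : Ed \in T -> \sum_x pr x * (@f n) x Ed.1 = Ed.2.
    by move=> EdT; have [_ ->] := hT _ EdT.
  exists w, t, (@learned_prep R (L n) q); split.
  - move: run; rewrite /learner_run -!map_comp; congr (runs (real_inputs (_ :: _)) _ _ _ _).
    exact/eq_in_map.
  - apply: (@natr_poly_le R t (c1 + c2) n (size T) Z).
      apply: leq_trans tb (leq_trans (time1 N) _).
      by apply: leq_pow; apply: leq_addr.
    by rewrite /Z -[X in X <= _]/((`|Num.floor eta^-1|%:Z)%:~R) gez0_abs ?floor_le
      ?floor_ge0 ?invr_ge0 ?ltW.
  - by split; [exact: learned_describes lq|exact: learned_preparation lq].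
  - move=> k keta; apply: leq_trans (learned_vsize eta0 lq keta) _.
    have Lnk : (#|L n| <= sz (n + k))%N by apply: leq_trans (hs n) (mono _ _ _ (leq_addr _ _)).
    apply: leq_trans (leq_trans (size1 (n + k)%N) (leq_pow _ (leq_addl _ _))).
    by rewrite leq_add2r leq_mul //; lia.
  - move=> Ed EdT; have [_ _ _ _ err] := lq.
    have iT : (index Ed T < size Es)%N by rewrite sE index_mem.
    have := err _ iT; rewrite (nth_map (0, 0)) ?index_mem // nth_index //= dE //.
    by rewrite (learned_response lq).
split; first by exists (c1 + c2)%N; apply: part1.
set c3 := (c1 + c2)%N in part1 *.
(* [be] covers all inputs of the predictor and the calls for f, while [bb] covers the unreduced
   partial sums. *)
pose be x := (x + tm x + cbits a + 3)%N.
pose bb x := (x.+1 * (2 * be x * x.+1 + 4 * be x + 2))%N.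
have [c4 time2] : poly_bounded (fun x =>
    weight (predictor a) * bb x ^ weight (predictor a))%N.
  by rewrite /bb /be; auto 30 with poly.
(* The time is polynomial in n plus the size of w, and that size is polynomial in n + k; the
   composition eliminates w. *)
have [c5 time3] : poly_bounded (fun x => c4 * (x + c3 * x.+1 ^ c3).+1 ^ c4)%N.
  by auto 30 with poly.
exists c5 => n pr eta T w t q E pr_prep eta0 hT run [rs [Ew rsL rs_pos qE]] q_prep ME.
(* The given run is the one found in the first part, so its output w inherits the size bound. *)
have vw k : 2%:R ^- k <= eta -> (vsize w <= c3 * (n + k).+1 ^ c3)%N.
  have [w' [t' [q' [[s1 [e1 <-]] _ _ h _]]]] := part1 n pr eta T pr_prep eta0 hT.
  by have [s2 [e2 <-]] := run; have [<- _] := exec_det e1 e2; apply: h.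
pose x := (n + vsize w)%N.
have rsw : (size rs < vsize w)%N.
  by rewrite Ew -(size_map enc_frac) size_vsize_enc_seq.
have tmn : (ct * n.+1 ^ ct <= tm x)%N by apply: mono; rewrite leq_addr.
have F_run l : (l < size rs)%N -> exists v t, [/\ runs no_reals a
    (enc_seq [:: enc_nat n; enc_nat l; enc_bits (mdesc n E)]) v t,
    is_value v (by_rank ((@f n) ^~ E) l) & (t <= be x)%N].
  move=> ls; have [y <-] := rank_onto (leq_trans ls rsL).
  have [v [t' [hv vx tb]]] := ha n y _ ME.
  exists v, t'; rewrite by_rank_rank; split=> //.
  by apply: leq_trans tb (leq_trans tmn _); rewrite /be; lia.
have [||||||v [t' [run' vx tb]]] :=
  @predictor_run R (bb x) (be x) no_reals a n (enc_bits (mdesc n E)) rs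
    (by_rank ((@f n) ^~ E)) _ rs_pos _ _ _ _ F_run.
- by rewrite /be; lia.
- have : (tbits w <= be x)%N by apply: leq_trans (tbits_vsize w) _; rewrite /be /x; lia.
  by rewrite Ew => /tbits_enc_seq_all; rewrite all_map.
- by apply: bitlen_leq_abs; rewrite /be /x; lia.
- by apply: leq_trans (tbits_enc_bits _) _; rewrite /be; lia.
- by rewrite /be /x; lia.
- by rewrite /bb leq_mul //; [rewrite /x; lia|rewrite !leq_add // leq_mul // /x; lia].
exists v, t'; split.
- by rewrite Ew.
- by rewrite (response_describes _ _ rsL qE).
- move=> k keta; apply: leq_trans tb (leq_trans (time2 x) _).
  apply: leq_trans (leq_trans (time3 (n + k)%N) _); last by [].
  by apply: mono; rewrite /x leq_add ?leq_addr ?vw.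
Qed.
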